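(* Let $\Omega$ be a nonempty open subset of $\mathbb R^d$. Then $\mathcal G(\Omega)=\widetilde{\mathcal G}(\widetilde\Omega_c)$; that is, the map $[(u_\varepsilon)_\varepsilon]\mapsto[({u_\varepsilon}_{|\Omega})_\varepsilon]$, restricting representatives from $\mathbb R^d$ to $\Omega$, is a well-defined isomorphism of differential algebras $\widetilde{\mathcal G}(\widetilde\Omega_c)\to\mathcal G(\Omega)$.
   Context: Nets are indexed by $\varepsilon\in(0,1)$; ''for small $\varepsilon$'' means for all $\varepsilon\le\varepsilon_0$ for some $\varepsilon_0\in(0,1)$; $0\in\mathbb N$. For $E=\mathbb C$ or $E=\mathbb R^d$, a net $(x_\varepsilon)_\varepsilon$ in $E$ is moderate ($\in\mathcal M_E$) if there is $N\in\mathbb N$ with $|x_\varepsilon|\le\varepsilon^{-N}$ for small $\varepsilon$, and negligible ($\in\mathcal N_E$) if for each $m\in\mathbb N$, $|x_\varepsilon|\le\varepsilon^m$ for small $\varepsilon$. $\widetilde{\mathbb R}^d=\mathcal M_{\mathbb R^d}/\mathcal N_{\mathbb R^d}$; $[(x_\varepsilon)_\varepsilon]$ is the class of $(x_\varepsilon)_\varepsilon$. $\mathcal G(\Omega)$ (the special Colombeau algebra) is the quotient of the algebra of nets $(u_\varepsilon)_\varepsilon\in C^\infty(\Omega)^{(0,1)}$ such that for every compact $K\subset\Omega$ and $\alpha\in\mathbb N^d$ there is $N\in\mathbb N$ with $\sup_{x\in K}|\partial^\alpha u_\varepsilon(x)|\le\varepsilon^{-N}$ for small $\varepsilon$, by the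 ideal of nets such that for every compact $K\subset\Omega$, $\alpha\in\mathbb N^d$ and $m\in\mathbb N$, $\sup_{x\in K}|\partial^\alpha u_\varepsilon(x)|\le\varepsilon^m$ for small $\varepsilon$. For $K\subseteq\mathbb R^d$, $\widetilde K$ is the set of $\tilde x\in\widetilde{\mathbb R}^d$ having a representative $(x_\varepsilon)_\varepsilon$ with $x_\varepsilon\in K$ for small $\varepsilon$. $\widetilde\Omega_c=\bigcup_{K\subset\Omega\text{ compact}}\widetilde K$. For $\emptyset\ne A\subseteq\widetilde{\mathbb R}^d$, $\widetilde{\mathcal G}(A)=\mathcal E_M(A)/\mathcal N(A)$, where $\mathcal E_M(A)$ (resp. $\mathcal N(A)$) is the set of nets $(u_\varepsilon)_\varepsilon$ of $C^\infty$ functions $\mathbb R^d\to\mathbb C$ such that for every $\alpha\in\mathbb N^d$ and every representative $(x_\varepsilon)_\varepsilon$ of every element of $A$, $(\partial^\alpha u_\varepsilon(x_\varepsilon))_\varepsilon\in\mathcal M_{\mathbb C}$ (resp. $\in\mathcal N_{\mathbb C}$). All operations (including derivatives) are $\varepsilon$-wise. *)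

(* Defs.v *)
From HB Require Import structures.
From mathcomp Require Import all_boot all_order all_algebra.
From mathcomp Require Import all_classical all_reals all_analysis.
From mathcomp Require Import ring complex generic_quotient ring_quotient.

Set Implicit Arguments.
Unset Strict Implicit.
Unset Printing Implicit Defensive.

Import Order.TTheory GRing.Theory Num.Theory.
Import numFieldNormedType.Exports.

Local Open Scope classical_set_scope.
Local Open Scope ring_scope.

Section RealSmooth.
Variables (R : realType) (d : nat).
Local Notation E := 'rV[R]_d.
Implicit Types (f g : E -> R) (O : set E) (s : seq 'I_d).

Definition partial (i : 'I_d) f : E -> R := fun x => 'D_(delta_mx 0 i) f x.

Definition partials s f : E -> R := foldr partial f s.

(* C^oo on the open set O: every iterated partial derivative exists and is
   continuous at every point of O; values outside O are irrelevant. *)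
Definition smooth_on O f := forall s x, O x ->
  {for x, continuous (partials s f)} /\
  forall i, derivable (partials s f) x (delta_mx 0 i).

Lemma partials_rcons s i f : partials (rcons s i) f = partials s (partial i f).
Proof. by rewrite /partials foldr_rcons. Qed.

Lemma partials_cat s1 s2 f : partials (s1 ++ s2) f = partials s1 (partials s2 f).
Proof. by rewrite /partials foldr_cat. Qed.

Lemma partial_eq O f g i : open O -> {in O, f =1 g} ->
  {in O, partial i f =1 partial i g}.
Proof.
move=> oO fg x xO; apply: near_eq_derive.
have : nbhs x O by apply: open_nbhs_nbhs; split=> //; exact: set_mem.
by apply: filterS => y Oy; apply: fg; exact: mem_set.
Qed.

Lemma partials_eq O f g s : open O -> {in O, f =1 g} ->
  {in O, partials s f =1 partials s g}.
Proof. by move=> oO fg; elim: s => //= i s IH; apply: partial_eq. Qed.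

Let good f x := {for x, continuous f} /\
  forall i, derivable f x (delta_mx 0 i).

Let good_eq O f g x : open O -> {in O, f =1 g} -> O x -> good f x -> good g x.
Proof.
move=> oO fg Ox [cf df].
have Onear : \forall y \near x, f y = g y.
  have : nbhs x O by apply: open_nbhs_nbhs.
  by apply: filterS => y Oy; apply: fg; exact: mem_set.
split; last by move=> i; apply: near_eq_derivable (df i).
have /= gx := fg x (mem_set Ox).
move=> A; rewrite -gx => /cf fA.
rewrite nbhs_simpl/=; near=> y.
by rewrite /= -(near Onear y)//; near: y; exact: fA.
Unshelve. all: by end_near.
Qed.

Let goodn n O f := forall s x, (size s <= n)%N -> O x -> good (partials s f) x.

Let goodn_smooth n O f : smooth_on O f -> goodn n O f.
Proof. by move=> sf s x _ Ox; apply: sf. Qed.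

Let goodn_eq n O f g : open O -> {in O, f =1 g} -> goodn n O f -> goodn n O g.
Proof.
by move=> oO fg gf s x ss Ox; apply: (good_eq oO (partials_eq s oO fg)) => //; exact: gf.
Qed.

Let smooth_goodn O f : (forall n, goodn n O f) -> smooth_on O f.
Proof. by move=> h s x Ox; apply: (h (size s)). Qed.

Lemma smooth_on_eq O f g : open O -> {in O, f =1 g} ->
  smooth_on O f -> smooth_on O g.
Proof.
by move=> oO fg sf; apply: smooth_goodn => n; apply: goodn_eq oO fg _; apply: goodn_smooth.
Qed.

Lemma smooth_partial O f i : smooth_on O f -> smooth_on O (partial i f).
Proof. by move=> sf s x Ox; rewrite -partials_rcons; apply: sf. Qed.

Lemma smooth_partials O f s : smooth_on O f -> smooth_on O (partials s f).
Proof. by move=> sf; elim: s => [//|i s IH]; exact: (@smooth_partial O _ i IH). Qed.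

Let goodD f g x : good f x -> good g x -> good (f + g) x.
Proof.
move=> [cf df] [cg dg]; split; first exact: continuousD.
by move=> i; apply: derivableD.
Qed.

Let partialsD_n n O f g s : open O -> goodn n O f -> goodn n O g ->
  (size s <= n.+1)%N -> {in O, partials s (f + g) =1 partials s f + partials s g}.
Proof.
move=> oO gf gg; elim: s => //= i s IH ss x xO.
rewrite (partial_eq i oO (IH _) xO) 1?ltnW//.
rewrite /partial deriveD//.
- by case: (gf s x) => //; exact: set_mem.
- by case: (gg s x) => //; exact: set_mem.
Qed.

Let goodnD n O f g : open O -> goodn n O f -> goodn n O g -> goodn n O (f + g).
Proof.
move=> oO gf gg s x ss Ox.
apply: (@good_eq O (partials s f + partials s g)) => //.
  by move=> y yO /=; rewrite (@partialsD_n n O)// ltnW.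
by apply: goodD; [exact: gf|exact: gg].
Qed.

Lemma partialsD O f g s : open O -> smooth_on O f -> smooth_on O g ->
  {in O, partials s (f + g) =1 partials s f + partials s g}.
Proof.
by move=> oO sf sg; apply: (@partialsD_n (size s)) => //; apply: goodn_smooth.
Qed.

Lemma smooth_onD O f g : open O -> smooth_on O f -> smooth_on O g ->
  smooth_on O (f + g).
Proof.
by move=> oO sf sg; apply: smooth_goodn => n; apply: goodnD => //; apply: goodn_smooth.
Qed.

Let goodM f g x : good f x -> good g x -> good (f * g) x.
Proof.
move=> [cf df] [cg dg]; split; first exact: continuousM.
by move=> i; apply: derivableM.
Qed.

Lemma partialM O f g i : smooth_on O f -> smooth_on O g ->
  {in O, partial i (f * g) =1 partial i f * g + f * partial i g}.
Proof.
move=> sf sg x /set_mem Ox; have [_ df] := sf [::] x Ox; have [_ dg] := sg [::] x Ox.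
by rewrite /partial deriveM// addrC /GRing.scale/= [X in X + _]mulrC.
Qed.

Lemma smooth_onM O f g : open O -> smooth_on O f -> smooth_on O g ->
  smooth_on O (f * g).
Proof.
move=> oO sf sg; apply: smooth_goodn => n.
elim: n f g sf sg => [|n IH] f g sf sg s x.
  rewrite leqn0 size_eq0 => /eqP -> Ox.
  by apply: goodM; [exact: (sf [::])|exact: (sg [::])].
case/lastP: s => [_ Ox|s i].
  by apply: goodM; [exact: (sf [::])|exact: (sg [::])].
rewrite size_rcons ltnS partials_rcons => ss Ox.
suff : goodn n O (partial i (f * g)) by apply.
apply: (@goodn_eq _ _ (partial i f * g + f * partial i g)) => //.
  by move=> y yO; rewrite (@partialM O).
have sf' := @smooth_partial O f i sf; have sg' := @smooth_partial O g i sg.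
exact: (goodnD oO (IH _ _ sf' sg) (IH _ _ sf sg')).
Qed.

Lemma partials_cst s c : partials s (cst c) = cst (if s is [::] then c else 0).
Proof.
elim: s => // i s /= ->; apply/funext => x; exact: derive_cst.
Qed.

Lemma smooth_on_cst O c : smooth_on O (cst c).
Proof.
move=> s x Ox; rewrite partials_cst; split; first exact: cst_continuous.
by move=> i; exact: derivable_cst.
Qed.

Lemma smooth_onN O f : open O -> smooth_on O f -> smooth_on O (- f).
Proof.
move=> oO sf; rewrite (_ : - f = cst (-1) * f); last first.
  by apply/funext => x; rewrite [RHS]mulN1r.
exact: (smooth_onM oO (@smooth_on_cst O (-1)) sf).
Qed.

Lemma partialsN O f s : open O -> smooth_on O f ->
  {in O, partials s (- f) =1 - partials s f}.
Proof.
move=> oO sf x xO; apply/eqP; rewrite -addr_eq0.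
have := partialsD s oO (smooth_onN oO sf) sf xO.
rewrite addNr (partials_cst s 0) => /esym/eqP.
by rewrite /cst; case: s.
Qed.

End RealSmooth.

Section Schwarz.
Variables (R : realType) (d : nat).
Local Notation E := 'rV[R]_d.
Implicit Types (f g : E -> R) (O : set E) (s : seq 'I_d) (i j : 'I_d).
Local Notation ev i := (delta_mx 0 i : E).

Lemma is_derive_line f (x v : E) (t : R) : derivable f (x + t *: v) v ->
  is_derive t 1 (fun r => f (x + r *: v)) ('D_v f (x + t *: v)).
Proof.
move=> df.
have eqf : (fun h : R => h^-1 *: (((fun r => f (x + r *: v)) \o shift t) (h *: 1)
                - f (x + t *: v)))
  = (fun h : R => h^-1 *: ((f \o shift (x + t *: v)) (h *: v) - f (x + t *: v))).
  apply/funext => h /=; congr (_ *: (f _ - _)).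
  by rewrite [h *: 1]mulr1 scalerDl addrCA.
by split; [rewrite /derivable eqf|rewrite /derive eqf].
Qed.

Lemma second_difference O f x i j (h : R) : 0 < h -> smooth_on O f ->
  (forall s t : R, 0 <= s <= h -> 0 <= t <= h -> O (x + s *: ev i + t *: ev j)) ->
  exists s t : R, [/\ 0 <= s <= h, 0 <= t <= h &
    f (x + h *: ev i + h *: ev j) - f (x + h *: ev i)
      - (f (x + h *: ev j) - f x)
    = h * h * partial j (partial i f) (x + s *: ev i + t *: ev j)].
Proof.
move=> h0 sf boxO; have hh : 0 <= h <= h by rewrite ltW/=.
have h00 : (0 : R) <= 0 <= h by rewrite lexx ltW.

pose phi r := f ((x + h *: ev j) + r *: ev i) - f (x + r *: ev i).
have dphi r : 0 <= r <= h -> is_derive r 1 phi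
   (partial i f ((x + h *: ev j) + r *: ev i) - partial i f (x + r *: ev i)).
  move=> hr; apply: is_deriveB; apply: is_derive_line.
    rewrite addrAC; exact: (sf [::] _ (boxO _ _ hr hh)).2.
  by have := (sf [::] _ (boxO _ _ hr h00)).2 i; rewrite scale0r addr0.
have cphi : {within `[0, h], continuous phi}.
  apply: continuous_in_subspaceT => r /set_mem; rewrite /= in_itv/= => /dphi[dr _].
  by apply: differentiable_continuous; exact/derivable1_diffP.
have [s] := MVT h0 (fun r hr => dphi r (subset_itv_oo_cc hr)) cphi.
rewrite in_itv/= subr0 => /andP[s0 sh] phiE.
have hs : 0 <= s <= h by rewrite !ltW.
pose psi r := partial i f ((x + s *: ev i) + r *: ev j).
have dpsi r : 0 <= r <= h -> is_derive r 1 psi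
   (partial j (partial i f) ((x + s *: ev i) + r *: ev j)).
  by move=> hr; apply: is_derive_line; exact: (sf [:: i] _ (boxO _ _ hs hr)).2.
have cpsi : {within `[0, h], continuous psi}.
  apply: continuous_in_subspaceT => r /set_mem; rewrite /= in_itv/= => /dpsi[dr _].
  by apply: differentiable_continuous; exact/derivable1_diffP.
have [t] := MVT h0 (fun r hr => dpsi r (subset_itv_oo_cc hr)) cpsi.
rewrite in_itv/= subr0 => /andP[t0 th] psiE.
exists s, t; split=> //; first by rewrite !ltW.
rewrite -mulrA [h * (h * _)]mulrC [h * partial _ _ _]mulrC -psiE.
move: phiE; rewrite /phi /psi !scale0r !addr0 => phiE.
rewrite [x + h *: _ + _]addrAC phiE; congr (_ * _).
by rewrite [x + _ + s *: _]addrAC.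
Qed.

Lemma norm_delta_le i : `|ev i| <= 1.
Proof.
change (mx_norm (ev i) <= 1); rewrite mx_normrE; apply: bigmax_le => //= -[a b] _ /=.
by rewrite !mxE normr_nat lern1; case: andP.
Qed.

Lemma partialC O f i j : open O -> smooth_on O f ->
  {in O, partial i (partial j f) =1 partial j (partial i f)}.
Proof.
move=> oO sf x /set_mem Ox; apply/eqP/negPn/negP => neq.
set A := partial i (partial j f); set B := partial j (partial i f).
pose e := `|A x - B x| / 2.
have e0 : 0 < e by rewrite divr_gt0// normr_gt0 subr_eq0.
have cA : A @ x --> A x := (sf [:: i; j] x Ox).1.
have cB : B @ x --> B x := (sf [:: j; i] x Ox).1.
have Onx : nbhs x O by apply: open_nbhs_nbhs.
have /nbhs_ballP[r /= r0 xr] : \forall y \near x,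
    [/\ O y, `|A x - A y| < e & `|B x - B y| < e].
  have nA : \forall y \near x, `|A x - A y| < e by have /cvgrPdist_lt/(_ e e0) h := cA; exact: h.
  have nB : \forall y \near x, `|B x - B y| < e by have /cvgrPdist_lt/(_ e e0) h := cB; exact: h.
  by apply: filterS3 Onx nA nB => y.
pose h := r / 3.
have h0 : 0 < h by rewrite divr_gt0.
have inr_ k l (s t : R) : 0 <= s <= h -> 0 <= t <= h ->
    ball x r (x + s *: ev k + t *: ev l).
  move=> /andP[s0 sh] /andP[t0 th]; rewrite -ball_normE/= -addrA opprD addNKr.
  rewrite normrN (le_lt_trans (ler_normD _ _))// !normrZ !ger0_norm//.
  rewrite (@le_lt_trans _ _ (h + h))//.
    by rewrite lerD// -[leRHS]mulr1 ler_pM// norm_delta_le.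
  by rewrite /h -mulrDl ltr_pdivrMr// mulr_natr (mulrS r 2) -mulr2n ltrDr.
have box k l (s t : R) hs ht := let: And3 a _ _ := xr _ (inr_ k l s t hs ht) in a.
have [s [t [hs ht sE]]] := second_difference h0 sf (box i j).
have [s' [t' [hs' ht' s'E]]] := second_difference h0 sf (box j i).
have [_ _ Bn] := xr _ (inr_ i j s t hs ht).
have [_ An _] := xr _ (inr_ j i s' t' hs' ht').
have AB : A (x + s' *: ev j + t' *: ev i) = B (x + s *: ev i + t *: ev j).
  have hh0 : h * h != 0 by rewrite mulf_neq0// gt_eqF.
  refine (mulfI hh0 _).
  refine (etrans (esym s'E) (etrans _ sE)).
  rewrite [x + _ + _]addrAC !opprB addrACA.
  by rewrite [in RHS]addrACA; congr (_ + _); rewrite addrC.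
move: Bn An; rewrite -AB /e; clear.
move: (A (x + s' *: ev j + t' *: ev i)) (A x) (B x) => z a b bz az.
have := ltrD az bz; rewrite -splitr ltNge (distrC b z) => /negP; apply.
exact: ler_distD.
Qed.

Lemma partials_rem O f i s : open O -> smooth_on O f -> i \in s ->
  {in O, partials s f =1 partials (i :: rem i s) f}.
Proof.
move=> oO sf; elim: s => //= j s IH; rewrite inE; case: eqVneq => [->//|_ /= /IH{}IH].
move=> x xO; rewrite (partial_eq j oO IH xO)/=.
by apply: (partialC _ _ oO _ xO); exact: smooth_partials.
Qed.

Lemma partials_perm O f s1 s2 : open O -> smooth_on O f -> perm_eq s1 s2 ->
  {in O, partials s1 f =1 partials s2 f}.
Proof.
move=> oO sf; elim: s1 s2 => [|i s1 IH] s2 s12 x xO.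
  by move: s12; rewrite perm_sym => /perm_nilP ->.
have is2 : i \in s2 by rewrite -(perm_mem s12) mem_head.
rewrite (partials_rem oO sf is2 xO)/=.
apply: (partial_eq i oO _ xO); apply: IH.
by move: (perm_to_rem is2) => /(perm_trans s12); rewrite perm_cons.
Qed.

End Schwarz.

Section ComplexSmooth.
Variables (R : realType) (d : nat).
Local Notation E := 'rV[R]_d.
Local Notation C := R[i].
Implicit Types (f g : E -> C) (O : set E) (s : seq 'I_d) (alpha : 'I_d -> nat).

(* R[i] carries no norm over R, so complex-valued functions are differentiated
   through their real and imaginary parts. *)
Definition csmooth_on O f := smooth_on O (@complex.Re R \o f) /\ smooth_on O (@complex.Im R \o f).

Definition cpartials s f : E -> C :=
  fun x => (partials s (@complex.Re R \o f) x +i* partials s (@complex.Im R \o f) x)%C.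

Definition midx_seq alpha : seq 'I_d :=
  flatten [seq nseq (alpha i) i | i <- enum 'I_d].

(* The derivative of f of multi-index alpha; on smooth functions the order of
   the partial derivatives is irrelevant, see cpartials_perm. *)
Definition mderiv alpha f : E -> C := cpartials (midx_seq alpha) f.

Lemma midx_seq_count s : perm_eq (midx_seq (fun i => count_mem i s)) s.
Proof.
rewrite /midx_seq; apply/allP => i _ /=; rewrite count_flatten -!map_comp.
rewrite sumnE big_map -enumT big_enum/= (bigD1 i)//= big1 => [|j ji].
  by rewrite count_nseq/= eqxx mul1n addn0.
by rewrite count_nseq/= (negbTE ji).
Qed.

Lemma cpartials_perm O f s1 s2 : open O -> csmooth_on O f -> perm_eq s1 s2 ->
  {in O, cpartials s1 f =1 cpartials s2 f}.
Proof.
move=> oO [sr si] s12 x xO.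
by rewrite /cpartials (partials_perm oO sr s12 xO) (partials_perm oO si s12 xO).
Qed.

Lemma cpartials_mderiv O f s : open O -> csmooth_on O f ->
  {in O, cpartials s f =1 mderiv (fun i => count_mem i s) f}.
Proof.
by move=> oO sf; apply: cpartials_perm => //; rewrite perm_sym midx_seq_count.
Qed.

Lemma csmooth_on_eq O f g : open O -> {in O, f =1 g} ->
  csmooth_on O f -> csmooth_on O g.
Proof.
move=> oO fg [sr si]; split.
  by apply: (smooth_on_eq oO _ sr) => x xO /=; rewrite fg.
by apply: (smooth_on_eq oO _ si) => x xO /=; rewrite fg.
Qed.

Lemma cpartials_eq O f g s : open O -> {in O, f =1 g} ->
  {in O, cpartials s f =1 cpartials s g}.
Proof.
move=> oO fg x xO; rewrite /cpartials.
rewrite (@partials_eq _ _ O (@complex.Re R \o f) (@complex.Re R \o g))//; last first.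
  by move=> y yO /=; rewrite fg.
rewrite (@partials_eq _ _ O (@complex.Im R \o f) (@complex.Im R \o g))//.
by move=> y yO /=; rewrite fg.
Qed.

Definition cpartial i f := cpartials [:: i] f.

Lemma cpartials_rcons s i f :
  cpartials (rcons s i) f = cpartials s (cpartial i f).
Proof. by rewrite /cpartials !partials_rcons. Qed.

Lemma csmooth_cpartial O f i : csmooth_on O f -> csmooth_on O (cpartial i f).
Proof. by move=> [sr si]; split; exact: smooth_partial. Qed.

Let ReD f g : @complex.Re R \o (f + g) = (@complex.Re R \o f) + (@complex.Re R \o g).
Proof. by apply/funext => x /=; rewrite !fctE/=; case: (f x); case: (g x). Qed.
Let ImD f g : @complex.Im R \o (f + g) = (@complex.Im R \o f) + (@complex.Im R \o g).
Proof. by apply/funext => x /=; rewrite !fctE/=; case: (f x); case: (g x). Qed.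
Let ReN f : @complex.Re R \o (- f) = - (@complex.Re R \o f).
Proof. by apply/funext => x /=; rewrite !fctE/=; case: (f x). Qed.
Let ImN f : @complex.Im R \o (- f) = - (@complex.Im R \o f).
Proof. by apply/funext => x /=; rewrite !fctE/=; case: (f x). Qed.
Let ReM f g : @complex.Re R \o (f * g) =
  (@complex.Re R \o f) * (@complex.Re R \o g) + (- (@complex.Im R \o f)) * (@complex.Im R \o g).
Proof.
by apply/funext => x /=; rewrite !fctE/=; case: (f x) => a b; case: (g x) => a' b' /=; rewrite mulNr.
Qed.
Let ImM f g : @complex.Im R \o (f * g) =
  (@complex.Re R \o f) * (@complex.Im R \o g) + (@complex.Im R \o f) * (@complex.Re R \o g).
Proof.
by apply/funext => x /=; rewrite !fctE/=; case: (f x) => a b; case: (g x) => a' b' /=.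
Qed.

Lemma csmooth_onD O f g : open O -> csmooth_on O f -> csmooth_on O g ->
  csmooth_on O (f + g).
Proof.
move=> oO [fr fi] [gr gi]; split; rewrite ?ReD ?ImD.
  exact: (smooth_onD oO fr gr).
exact: (smooth_onD oO fi gi).
Qed.

Lemma csmooth_onN O f : open O -> csmooth_on O f -> csmooth_on O (- f).
Proof.
move=> oO [fr fi]; split; rewrite ?ReN ?ImN.
  exact: (smooth_onN oO fr).
exact: (smooth_onN oO fi).
Qed.

Lemma csmooth_onM O f g : open O -> csmooth_on O f -> csmooth_on O g ->
  csmooth_on O (f * g).
Proof.
move=> oO [fr fi] [gr gi]; split; rewrite ?ReM ?ImM.
  have H := smooth_onM oO (smooth_onN oO fi) gi.
  exact: (smooth_onD oO (smooth_onM oO fr gr) H).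
exact: (smooth_onD oO (smooth_onM oO fr gi) (smooth_onM oO fi gr)).
Qed.

Lemma csmooth_on_cst O (c : C) : csmooth_on O (cst c).
Proof.
split.
  rewrite (_ : _ \o _ = cst (complex.Re c)); [exact: smooth_on_cst|by []].
rewrite (_ : _ \o _ = cst (complex.Im c)); [exact: smooth_on_cst|by []].
Qed.

Lemma cpartialsD O f g s : open O -> csmooth_on O f -> csmooth_on O g ->
  {in O, cpartials s (f + g) =1 cpartials s f + cpartials s g}.
Proof.
move=> oO [fr fi] [gr gi] x xO; rewrite /cpartials ReD ImD.
by rewrite (partialsD s oO fr gr xO) (partialsD s oO fi gi xO).
Qed.

Lemma cpartialsN O f s : open O -> csmooth_on O f ->
  {in O, cpartials s (- f) =1 - cpartials s f}.
Proof.
move=> oO [fr fi] x xO; rewrite /cpartials ReN ImN.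
by rewrite (partialsN s oO fr xO) (partialsN s oO fi xO).
Qed.

Lemma cpartials_cst s (c : C) : cpartials s (cst c) = cst (if s is [::] then c else 0).
Proof.
apply/funext => x; rewrite /cpartials.
rewrite (_ : complex.Re (R:=R) \o _ = cst (complex.Re c))// partials_cst.
rewrite (_ : complex.Im (R:=R) \o _ = cst (complex.Im c))// partials_cst.
by case: s => //; case: c.
Qed.

Lemma cpartialM O f g i : open O -> csmooth_on O f -> csmooth_on O g ->
  {in O, cpartial i (f * g) =1 cpartial i f * g + f * cpartial i g}.
Proof.
move=> oO [fr fi] [gr gi] x xO; rewrite /cpartial /cpartials ReM ImM /=.
have Nfi := smooth_onN oO fi.
have D1 := partialsD [:: i] oO (smooth_onM oO fr gr) (smooth_onM oO Nfi gi) xO.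
have D2 := partialsD [:: i] oO (smooth_onM oO fr gi) (smooth_onM oO fi gr) xO.
have addE (h k : E -> R) y : (h + k) y = h y + k y by [].
rewrite /= in D1 D2; rewrite D1 D2 !addE.
rewrite (partialM i fr gr xO) (partialM i Nfi gi xO).
rewrite (partialM i fr gi xO) (partialM i fi gr xO) !fctE /=.
have /= -> := partialsN [:: i] oO fi xO.
case: (f x) => a b; case: (g x) => a' b' /=; rewrite !fctE /=.
apply/eqP; rewrite eq_complex/=; apply/andP; split; apply/eqP.
  by rewrite !mulNr addrACA -!addrA; congr (_ + _); rewrite addrCA.
by rewrite addrACA -!addrA; congr (_ + _); rewrite addrCA.
Qed.

Fixpoint leibniz_seq (s : seq 'I_d) : seq (seq 'I_d * seq 'I_d) :=
  if s is i :: s' then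
    [seq (rcons p.1 i, p.2) | p <- leibniz_seq s'] ++
    [seq (p.1, rcons p.2 i) | p <- leibniz_seq s']
  else [:: ([::], [::])].

Lemma leibniz O f g s : open O -> csmooth_on O f -> csmooth_on O g ->
  {in O, cpartials s (f * g) =1
    fun x => \sum_(p <- leibniz_seq (rev s)) cpartials p.1 f x * cpartials p.2 g x}.
Proof.
move=> oO; elim/last_ind: s f g => [|s i IH] f g sf sg x xO.
  rewrite /= big_seq1 /cpartials/=.
  by rewrite [(f * g) x]/GRing.mul/=; case: (f x); case: (g x).
rewrite cpartials_rcons rev_rcons/= big_cat/= !big_map/=.
have sf' := csmooth_cpartial i sf; have sg' := csmooth_cpartial i sg.
have -> := cpartials_eq s oO (cpartialM i oO sf sg) xO.
have -> := cpartialsD s oO (csmooth_onM oO sf' sg) (csmooth_onM oO sf sg') xO.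
rewrite [LHS]/GRing.add/= (IH _ _ sf' sg x xO) (IH _ _ sf sg' x xO).
by congr (_ + _); apply: eq_bigr => p _; rewrite cpartials_rcons.
Qed.

End ComplexSmooth.

Section Nets.
Variable R : realType.

Definition Eps : Type := {e : R | 0 < e < 1}.

Definition for_small (P : Eps -> Prop) : Prop :=
  exists e0 : Eps, forall e : Eps, sval e <= sval e0 -> P e.

Definition moderate (r : Eps -> R) : Prop :=
  exists N : nat, for_small (fun e => r e <= sval e ^- N).

Definition negligible (r : Eps -> R) : Prop :=
  forall m : nat, for_small (fun e => r e <= sval e ^+ m).

Lemma Eps_gt0 (e : Eps) : 0 < sval e. Proof. by case: e => e /= /andP[]. Qed.
Lemma Eps_lt1 (e : Eps) : sval e < 1. Proof. by case: e => e /= /andP[]. Qed.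
Hint Resolve Eps_gt0 Eps_lt1 : core.

Lemma half_Eps : 0 < (2^-1 : R) < 1.
Proof. by rewrite invr_gt0 ltr0n invf_lt1 ?ltr1n// ltr0n. Qed.

Lemma for_small_le (P : Eps -> Prop) (a : R) : 0 < a ->
  (forall e : Eps, sval e <= a -> P e) -> for_small P.
Proof.
move=> a0 h; have m01 : 0 < Num.min a (2^-1 : R) < 1.
  have /andP[h0 h1] := half_Eps.
  by rewrite lt_min a0 h0/= gt_min h1 orbT.
exists (exist (fun e : R => 0 < e < 1) _ m01) => e /= em; apply: h; apply: le_trans em _.
by rewrite ge_min lexx.
Qed.

Lemma for_smallT (P : Eps -> Prop) : (forall e, P e) -> for_small P.
Proof. by move=> h; apply: (@for_small_le _ 1). Qed.

Lemma for_smallI (P Q : Eps -> Prop) : for_small P -> for_small Q ->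
  for_small (fun e => P e /\ Q e).
Proof.
move=> [a ha] [b hb]; apply: (@for_small_le _ (Num.min (sval a) (sval b))).
  by rewrite lt_min !Eps_gt0.
by move=> e; rewrite le_min => /andP[ea eb]; split; [exact: ha|exact: hb].
Qed.

Lemma for_smallS (P Q : Eps -> Prop) : (forall e, P e -> Q e) ->
  for_small P -> for_small Q.
Proof. by move=> PQ [a ha]; exists a => e ea; apply: PQ; exact: ha. Qed.

Lemma for_small_half : for_small (fun e => sval e <= 2^-1).
Proof. by exists (exist (fun e : R => 0 < e < 1) _ half_Eps). Qed.

Lemma for_small_not (P : Eps -> Prop) : (forall e, ~ P e) -> ~ for_small P.
Proof. by move=> h [e he]; apply: (h e); exact: he. Qed.

Lemma expV_le (e : Eps) m n : (m <= n)%N -> sval e ^- m <= sval e ^- n.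
Proof.
move=> mn; rewrite lef_pV2 ?posrE ?exprn_gt0//.
by rewrite ler_wiXn2l// ltW.
Qed.

Lemma double_expV (e : Eps) n : sval e <= 2^-1 ->
  sval e ^- n + sval e ^- n <= sval e ^- n.+1.
Proof.
move=> e2; rewrite -mulr2n -mulr_natl exprS invfM ler_pM2r ?invr_gt0 ?exprn_gt0//.
by rewrite -[leLHS]invrK lef_pV2 ?posrE// invr_gt0.
Qed.

Lemma double_exp (e : Eps) n : sval e <= 2^-1 ->
  sval e ^+ n.+1 + sval e ^+ n.+1 <= sval e ^+ n.
Proof.
move=> e2; rewrite -mulr2n -mulr_natl exprS mulrA -[leRHS]mul1r.
rewrite ler_pM2r ?exprn_gt0//.
by rewrite mulrC -ler_pdivlMr// mul1r.
Qed.

Section Uniform.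
Variables (T : Type) (K : Eps -> set T).
Local Notation normc := (@ComplexField.Normc.normc R).
Implicit Types u v : Eps -> T -> R[i].

Definition umod u := exists N : nat,
  for_small (fun e => forall x, K e x -> normc (u e x) <= sval e ^- N).

Definition uneg u := forall m : nat,
  for_small (fun e => forall x, K e x -> normc (u e x) <= sval e ^+ m).

Lemma umod_eq u v : (forall e x, K e x -> u e x = v e x) -> umod u -> umod v.
Proof.
move=> uv [N h]; exists N; apply: for_smallS h => e h x Kx.
by rewrite -uv//; exact: h.
Qed.

Lemma uneg_eq u v : (forall e x, K e x -> u e x = v e x) -> uneg u -> uneg v.
Proof.
move=> uv h m; apply: for_smallS (h m) => e {}h x Kx.
by rewrite -uv//; exact: h.
Qed.

Lemma uneg_umod u : uneg u -> umod u.
Proof.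
move=> h; exists 0%N; apply: for_smallS (h 0%N) => e {}h x Kx.
by rewrite expr0 invr1; have := h x Kx; rewrite expr0.
Qed.

Lemma umod_cst (c : R[i]) : umod (fun _ _ => c).
Proof.
have [|c1] := leP (normc c) 1.
  by move=> c1; exists 0%N; apply: for_smallT => e x _; rewrite expr0 invr1.
have c0 : 0 < normc c by apply: lt_trans c1.
exists 1%N; apply: (@for_small_le _ (normc c)^-1); first by rewrite invr_gt0.
move=> e ec x _; rewrite expr1 -[leLHS]invrK lef_pV2 ?posrE//.
by rewrite invr_gt0.
Qed.

Lemma uneg0 : uneg (fun _ _ => 0).
Proof.
move=> m; apply: for_smallT => e x _.
by rewrite ComplexField.Normc.normc0 exprn_ge0// ltW.
Qed.

Lemma umodD u v : umod u -> umod v -> umod (fun e x => u e x + v e x).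
Proof.
move=> [M hu] [N hv]; exists (maxn M N).+1.
apply: for_smallS (for_smallI for_small_half (for_smallI hu hv)) => e [e2 [{}hu {}hv]] x Kx.
apply: le_trans (double_expV _ e2); apply: le_trans (le_normcD _ _) _.
apply: lerD.
  by apply: le_trans (hu x Kx) _; apply: expV_le; exact: leq_maxl.
by apply: le_trans (hv x Kx) _; apply: expV_le; exact: leq_maxr.
Qed.

Lemma unegD u v : uneg u -> uneg v -> uneg (fun e x => u e x + v e x).
Proof.
move=> hu hv m.
apply: for_smallS (for_smallI for_small_half (for_smallI (hu m.+1) (hv m.+1))).
move=> e [e2 [{}hu {}hv]] x Kx.
apply: le_trans (double_exp _ e2); apply: le_trans (le_normcD _ _) _.
by apply: lerD; [exact: hu|exact: hv].
Qed.

Lemma umodN u : umod u -> umod (fun e x => - u e x).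
Proof.
move=> [N h]; exists N; apply: for_smallS h => e h x Kx.
by rewrite normcN; exact: h.
Qed.

Lemma unegN u : uneg u -> uneg (fun e x => - u e x).
Proof.
move=> h m; apply: for_smallS (h m) => e {}h x Kx.
by rewrite normcN; exact: h.
Qed.

Lemma normc_ge0 z : 0 <= normc z.
Proof. by case: z => a b; exact: sqrtr_ge0. Qed.

Lemma umodM u v : umod u -> umod v -> umod (fun e x => u e x * v e x).
Proof.
move=> [M hu] [N hv]; exists (M + N)%N.
apply: for_smallS (for_smallI hu hv) => e [{}hu {}hv] x Kx.
rewrite ComplexField.Normc.normcM exprD invfM.
by apply: ler_pM; rewrite ?normc_ge0//; [exact: hu|exact: hv].
Qed.

Lemma unegM u v : umod u -> uneg v -> uneg (fun e x => u e x * v e x).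
Proof.
move=> [M hu] hv m.
apply: for_smallS (for_smallI hu (hv (M + m)%N)) => e [{}hu {}hv] x Kx.
rewrite ComplexField.Normc.normcM.
have -> : sval e ^+ m = sval e ^- M * sval e ^+ (M + m).
  by rewrite exprD mulrA mulVf ?mul1r// expf_neq0// gt_eqF.
by apply: ler_pM; rewrite ?normc_ge0//; [exact: hu|exact: hv].
Qed.

Lemma umod_sum (I : Type) (L : seq I) (F : I -> Eps -> T -> R[i]) :
  (forall i, umod (F i)) -> umod (fun e x => \sum_(i <- L) F i e x).
Proof.
move=> h; elim: L => [|i L IH].
  by apply: umod_eq (umod_cst 0) => e x _; rewrite big_nil.
by apply: umod_eq (umodD (h i) IH) => e x _; rewrite big_cons.
Qed.

Lemma uneg_sum (I : Type) (L : seq I) (F : I -> Eps -> T -> R[i]) :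
  (forall i, uneg (F i)) -> uneg (fun e x => \sum_(i <- L) F i e x).
Proof.
move=> h; elim: L => [|i L IH].
  by apply: uneg_eq uneg0 => e x _; rewrite big_nil.
by apply: uneg_eq (unegD (h i) IH) => e x _; rewrite big_cons.
Qed.

End Uniform.

(* The closure properties below are stated for an arbitrary family of such
   sets, so that they apply to both algebras. *)
Section Tests.
Variables (d : nat) (O : set 'rV[R]_d) (TT : set (Eps -> set 'rV[R]_d)).
Hypothesis oO : open O.
Hypothesis TTO : forall K, TT K -> forall e x, K e x -> O x.
Implicit Types u v : Eps -> 'rV[R]_d -> R[i].

Definition tmod u := (forall e, csmooth_on O (u e)) /\
  forall K, TT K -> forall alpha, umod K (fun e => mderiv alpha (u e)).

Definition tneg u := (forall e, csmooth_on O (u e)) /\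
  forall K, TT K -> forall alpha, uneg K (fun e => mderiv alpha (u e)).

Let tmodP u : tmod u -> forall K, TT K -> forall s, umod K (fun e => cpartials s (u e)).
Proof.
move=> [su h] K TK s; apply: umod_eq (h K TK (fun i => count_mem i s)).
move=> e x /(TTO TK) /mem_set Ox.
by rewrite (cpartials_mderiv s oO (su e) Ox).
Qed.

Let tnegP u : tneg u -> forall K, TT K -> forall s, uneg K (fun e => cpartials s (u e)).
Proof.
move=> [su h] K TK s; apply: uneg_eq (h K TK (fun i => count_mem i s)).
move=> e x /(TTO TK) /mem_set Ox.
by rewrite (cpartials_mderiv s oO (su e) Ox).
Qed.

Lemma tmod_eq u v : (forall e, {in O, u e =1 v e}) -> tmod u -> tmod v.
Proof.
move=> uv [su h]; split=> [e|K TK alpha]; first exact: csmooth_on_eq (uv e) _.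
apply: umod_eq (h K TK alpha) => e x /(TTO TK) /mem_set Ox.
exact: (cpartials_eq _ oO (uv e) Ox).
Qed.

Lemma tneg_eq u v : (forall e, {in O, u e =1 v e}) -> tneg u -> tneg v.
Proof.
move=> uv [su h]; split=> [e|K TK alpha]; first exact: csmooth_on_eq (uv e) _.
apply: uneg_eq (h K TK alpha) => e x /(TTO TK) /mem_set Ox.
exact: (cpartials_eq _ oO (uv e) Ox).
Qed.

Lemma tmod_cst (c : R[i]) : tmod (fun _ => cst c).
Proof.
split=> [e|K TK alpha]; first exact: csmooth_on_cst.
apply: umod_eq (umod_cst K (if midx_seq alpha is [::] then c else 0)).
by move=> e x _; rewrite /mderiv cpartials_cst.
Qed.

Lemma tneg0 : tneg (fun _ => cst 0).
Proof.
split=> [e|K TK alpha]; first exact: csmooth_on_cst.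
apply: uneg_eq (uneg0 K) => e x _; rewrite /mderiv cpartials_cst.
by case: midx_seq.
Qed.

Lemma tmodD u v : tmod u -> tmod v -> tmod (fun e => u e + v e).
Proof.
move=> [su hu] [sv hv]; split=> [e|K TK alpha]; first exact: csmooth_onD.
apply: umod_eq (umodD (hu K TK alpha) (hv K TK alpha)).
move=> e x /(TTO TK) /mem_set Ox.
exact: esym (cpartialsD _ oO (su e) (sv e) Ox).
Qed.

Lemma tnegD u v : tneg u -> tneg v -> tneg (fun e => u e + v e).
Proof.
move=> [su hu] [sv hv]; split=> [e|K TK alpha]; first exact: csmooth_onD.
apply: uneg_eq (unegD (hu K TK alpha) (hv K TK alpha)).
move=> e x /(TTO TK) /mem_set Ox.
exact: esym (cpartialsD _ oO (su e) (sv e) Ox).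
Qed.

Lemma tmodN u : tmod u -> tmod (fun e => - u e).
Proof.
move=> [su hu]; split=> [e|K TK alpha]; first exact: csmooth_onN.
apply: umod_eq (umodN (hu K TK alpha)).
move=> e x /(TTO TK) /mem_set Ox.
exact: esym (cpartialsN _ oO (su e) Ox).
Qed.

Lemma tnegN u : tneg u -> tneg (fun e => - u e).
Proof.
move=> [su hu]; split=> [e|K TK alpha]; first exact: csmooth_onN.
apply: uneg_eq (unegN (hu K TK alpha)).
move=> e x /(TTO TK) /mem_set Ox.
exact: esym (cpartialsN _ oO (su e) Ox).
Qed.

Lemma tmodM u v : tmod u -> tmod v -> tmod (fun e => u e * v e).
Proof.
move=> hu hv; split=> [e|K TK alpha]; first exact: csmooth_onM (hu.1 e) (hv.1 e).
pose s := midx_seq alpha.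
apply: umod_eq (@umod_sum _ K _ (leibniz_seq (rev s))
  (fun p e x => cpartials p.1 (u e) x * cpartials p.2 (v e) x) _).
  move=> e x /(TTO TK) /mem_set Ox.
  by rewrite /mderiv (leibniz _ oO (hu.1 e) (hv.1 e) Ox).
by move=> p; exact: umodM (tmodP hu TK p.1) (tmodP hv TK p.2).
Qed.

Lemma tnegM u v : tmod u -> tneg v -> tneg (fun e => u e * v e).
Proof.
move=> hu hv; split=> [e|K TK alpha]; first exact: csmooth_onM (hu.1 e) (hv.1 e).
pose s := midx_seq alpha.
apply: uneg_eq (@uneg_sum _ K _ (leibniz_seq (rev s))
  (fun p e x => cpartials p.1 (u e) x * cpartials p.2 (v e) x) _).
  move=> e x /(TTO TK) /mem_set Ox.
  by rewrite /mderiv (leibniz _ oO (hu.1 e) (hv.1 e) Ox).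
by move=> p; exact: unegM (tmodP hu TK p.1) (tnegP hv TK p.2).
Qed.

Lemma tmod_partial u i : tmod u -> tmod (fun e => cpartial i (u e)).
Proof.
move=> hu; split=> [e|K TK alpha]; first exact: csmooth_cpartial (hu.1 e).
apply: umod_eq (tmodP hu TK (rcons (midx_seq alpha) i)) => e x _.
by rewrite cpartials_rcons.
Qed.

Lemma tneg_partial u i : tneg u -> tneg (fun e => cpartial i (u e)).
Proof.
move=> hu; split=> [e|K TK alpha]; first exact: csmooth_cpartial (hu.1 e).
apply: uneg_eq (tnegP hu TK (rcons (midx_seq alpha) i)) => e x _.
by rewrite cpartials_rcons.
Qed.

Lemma tneg1 K : TT K -> (forall e, K e !=set0) -> ~ tneg (fun _ => cst 1).
Proof.
move=> TK Kn [_ /(_ K TK (fun=> 0%N) 1%N)]; apply: for_small_not => e.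
have [x Kx] := Kn e; move=> /(_ x Kx); rewrite expr1 /mderiv.
have -> : midx_seq (fun=> 0%N) = [::] :> seq 'I_d.
  by rewrite /midx_seq; elim: (enum _).
by rewrite cpartials_cst ComplexField.Normc.normc1 leNgt Eps_lt1.
Qed.

End Tests.
End Nets.

Section QuotientAlgebra.
Variables (K : comNzRingType) (A : comAlgType K) (I : idealr A).
Local Notation Q := {ideal_quot I}.
Local Open Scope quotient_scope.

Definition quot_scale (c : K) (q : Q) : Q := \pi_Q (c *: 1) * q.

Lemma pi_scale c (x : A) : quot_scale c (\pi_Q x) = \pi_Q (c *: x).
Proof. by rewrite /quot_scale -rmorphM/= -scalerAl mul1r. Qed.

Let scaleA a b q : quot_scale a (quot_scale b q) = quot_scale (a * b) q.
Proof. by rewrite -[q]reprK !pi_scale scalerA. Qed.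
Let scale1 : left_id 1 quot_scale.
Proof. by move=> q; rewrite -[q]reprK !pi_scale scale1r. Qed.
Let scaleDr : right_distributive quot_scale +%R.
Proof. by move=> a p q; rewrite /quot_scale mulrDr. Qed.
Let scaleDl q : {morph quot_scale^~ q : a b / a + b}.
Proof. by move=> a b; rewrite /quot_scale scalerDl rmorphD mulrDl. Qed.

HB.instance Definition _ :=
  GRing.Zmodule_isLmodule.Build K Q scaleA scale1 scaleDr scaleDl.

Let scaleAl (a : K) (p q : Q) : a *: (p * q) = a *: p * q.
Proof. exact: mulrA. Qed.

HB.instance Definition _ := GRing.Lmodule_isLalgebra.Build K Q scaleAl.
HB.instance Definition _ := GRing.Lalgebra_isComAlgebra.Build K Q.

End QuotientAlgebra.

Section Colombeau.
Variables (R : realType) (d : nat) (O : set 'rV[R]_d).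
Local Notation C := R[i].
Local Notation normc := (@ComplexField.Normc.normc R).

(* A function on O is differentiated through its extension by zero, which is
   harmless since O is open. *)
Definition ext (f : O -> C) : 'rV[R]_d -> C := valL_ 0 f.

(* The bound on all of K is the bound on the supremum over K. *)
Definition moderate_on (u : Eps R -> O -> C) : Prop :=
  (forall e, csmooth_on O (ext (u e))) /\
  forall K : set 'rV[R]_d, compact K -> K `<=` O -> forall alpha : 'I_d -> nat,
    exists N : nat, for_small (fun e =>
      forall x, K x -> normc (mderiv alpha (ext (u e)) x) <= sval e ^- N).

Definition negligible_on (u : Eps R -> O -> C) : Prop :=
  (forall e, csmooth_on O (ext (u e))) /\
  forall K : set 'rV[R]_d, compact K -> K `<=` O -> forall alpha : 'I_d -> nat,
    forall m : nat, for_small (fun e =>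
      forall x, K x -> normc (mderiv alpha (ext (u e)) x) <= sval e ^+ m).

Let TT : set (Eps R -> set 'rV[R]_d) :=
  [set F | exists K, [/\ compact K, K `<=` O & F = fun=> K]].

Let TTO F : TT F -> forall e x, F e x -> O x.
Proof. by move=> [K [_ KO ->]] e; exact: KO. Qed.

Let moderate_onP u : moderate_on u <-> tmod O TT (fun e => ext (u e)).
Proof.
split=> -[su h]; split=> //.
  by move=> F [K [cK KO ->]] alpha; exact: h.
by move=> K cK KO alpha; apply: (h (fun=> K)); exists K.
Qed.

Let negligible_onP u : negligible_on u <-> tneg O TT (fun e => ext (u e)).
Proof.
split=> -[su h]; split=> //.
  by move=> F [K [cK KO ->]] alpha; exact: h.
by move=> K cK KO alpha; apply: (h (fun=> K)); exists K.
Qed.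

Lemma extE (f : O -> C) (x : O) : ext f (sval x) = f x.
Proof. exact: (congr1 (@^~ x) (valLK 0 f)). Qed.

Lemma ext_sigL (f : 'rV[R]_d -> C) : {in O, ext (sigL O f) =1 f}.
Proof. by move=> x xO; exact: (extE (sigL O f) (exist _ x xO)). Qed.

Let ext_eq (f : O -> C) (g : 'rV[R]_d -> C) :
  (forall x : O, f x = g (sval x)) -> {in O, ext f =1 g}.
Proof. by move=> fg x xO; rewrite (extE f (exist _ x xO)) fg. Qed.

Lemma extD f g : {in O, ext (f + g) =1 ext f + ext g}.
Proof. by apply: ext_eq => x; rewrite [RHS]/GRing.add/= !extE. Qed.
Lemma extN f : {in O, ext (- f) =1 - ext f}.
Proof. by apply: ext_eq => x; rewrite [RHS]/GRing.opp/= !extE. Qed.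
Lemma extM f g : {in O, ext (f * g) =1 ext f * ext g}.
Proof. by apply: ext_eq => x; rewrite [RHS]/GRing.mul/= !extE. Qed.
Lemma ext_cst c : {in O, ext (cst c) =1 cst c}.
Proof. exact: ext_eq. Qed.

Let eq_sym_in (f g : 'rV[R]_d -> C) : {in O, f =1 g} -> {in O, g =1 f}.
Proof. by move=> fg x xO; rewrite fg. Qed.

Section Open.
Hypothesis oO : open O.

Lemma moderate_onD u v : moderate_on u -> moderate_on v -> moderate_on (u + v).
Proof.
move=> /moderate_onP hu /moderate_onP hv; apply/moderate_onP.
apply: tmod_eq (tmodD oO TTO hu hv) => // e.
exact: eq_sym_in (extD (u e) (v e)).
Qed.

Lemma moderate_onN u : moderate_on u -> moderate_on (- u).
Proof.
move=> /moderate_onP hu; apply/moderate_onP.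
apply: tmod_eq (tmodN oO TTO hu) => // e.
exact: eq_sym_in (extN (u e)).
Qed.

Lemma moderate_onM u v : moderate_on u -> moderate_on v -> moderate_on (u * v).
Proof.
move=> /moderate_onP hu /moderate_onP hv; apply/moderate_onP.
apply: tmod_eq (tmodM oO TTO hu hv) => // e.
exact: eq_sym_in (extM (u e) (v e)).
Qed.

Lemma moderate_on_cst c : moderate_on (cst (cst c)).
Proof.
apply/moderate_onP; apply: tmod_eq (tmod_cst O TT c) => // e.
exact: eq_sym_in (@ext_cst c).
Qed.

Lemma negligible_on0 : negligible_on 0.
Proof.
apply/negligible_onP; apply: tneg_eq (tneg0 O TT) => // e.
exact: eq_sym_in (@ext_cst 0).
Qed.

Lemma negligible_onD u v : negligible_on u -> negligible_on v -> negligible_on (u + v).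
Proof.
move=> /negligible_onP hu /negligible_onP hv; apply/negligible_onP.
apply: tneg_eq (tnegD oO TTO hu hv) => // e.
exact: eq_sym_in (extD (u e) (v e)).
Qed.

Lemma negligible_onM u v : moderate_on u -> negligible_on v -> negligible_on (u * v).
Proof.
move=> /moderate_onP hu /negligible_onP hv; apply/negligible_onP.
apply: tneg_eq (tnegM oO TTO hu hv) => // e.
exact: eq_sym_in (extM (u e) (v e)).
Qed.

Lemma negligible_on1 : O !=set0 -> ~ negligible_on 1.
Proof.
move=> [x Ox] /negligible_onP h.
have : tneg O TT (fun=> cst 1).
  by apply: tneg_eq h => // e; exact: ext_cst.
apply: (@tneg1 _ _ _ _ (fun=> [set x])); last by move=> e; exists x.
by exists [set x]; split=> //; [exact: compact_set1|move=> _ ->].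
Qed.

Definition pderiv_on i (u : Eps R -> O -> C) : Eps R -> O -> C :=
  fun e => sigL O (cpartial i (ext (u e))).

Lemma moderate_on_pderiv i u : moderate_on u -> moderate_on (pderiv_on i u).
Proof.
move=> /moderate_onP hu; apply/moderate_onP.
apply: tmod_eq (tmod_partial oO TTO i hu) => // e.
exact: eq_sym_in (@ext_sigL _).
Qed.

Lemma negligible_on_pderiv i u : negligible_on u -> negligible_on (pderiv_on i u).
Proof.
move=> /negligible_onP hu; apply/negligible_onP.
apply: tneg_eq (tneg_partial oO TTO i hu) => // e.
exact: eq_sym_in (@ext_sigL _).
Qed.

Lemma pderiv_onB i u v : moderate_on u -> moderate_on v ->
  pderiv_on i (u - v) = pderiv_on i u - pderiv_on i v.
Proof.
move=> [su _] [sv _]; apply/funext => e; apply/funext => -[x xO].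
rewrite /pderiv_on/= /set_val/=.
have eB : {in O, ext (u e - v e) =1 ext (u e) + - ext (v e)}.
  by move=> y yO; rewrite (extD (u e) (- v e) yO) /GRing.add/= (extN (v e) yO).
rewrite /cpartial.
rewrite (cpartials_eq [:: i] oO eB xO).
rewrite (cpartialsD [:: i] oO (su e) (csmooth_onN oO (sv e)) xO).
by rewrite /GRing.add/= (cpartialsN [:: i] oO (sv e) xO).
Qed.

End Open.

Section Structure.
Variables (oO : open O) (O0 : O !=set0).

(* Nonemptiness of O only serves to make the ring of nets a nonzero ring, as
   the library's algebras require. *)
Definition moderate_on_pred of open O & O !=set0 : {pred Eps R -> O -> C} :=
  [pred u | `[< moderate_on u >]].

Let moderate_closed : subring_closed (moderate_on_pred oO O0).
Proof.
split=> [|u v /asboolP hu /asboolP hv|u v /asboolP hu /asboolP hv]; apply/asboolP.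
- exact: (moderate_on_cst oO 1).
- by apply: moderate_onD => //; exact: moderate_onN.
- exact: moderate_onM.
Qed.

Record moderate_nets := ModerateNet {
  moderate_net :> Eps R -> O -> C;
  _ : moderate_net \in moderate_on_pred oO O0
}.
Local Notation EM := moderate_nets.

HB.instance Definition _ := [isSub for moderate_net].
HB.instance Definition _ := [Choice of EM by <:].
HB.instance Definition _ := 
  GRing.SubChoice_isSubComPzRing.Build _ _ EM moderate_closed.

Lemma moderate_netP (u : EM) : moderate_on u.
Proof. by case: u => u /= /asboolP. Qed.

Let one_neq0 : (1 : EM) != 0.
Proof.
apply/eqP => /(congr1 val) h; apply: (negligible_on1 oO O0).
have -> : 1 = 0 :> (Eps R -> O -> C) by exact: h.
exact: negligible_on0.
Qed.
HB.instance Definition _ := GRing.PzSemiRing_isNonZero.Build EM one_neq0.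

Let cnet (c : C) : EM := ModerateNet (asboolT (moderate_on_cst oO c)).

Let mscale (c : C) (u : EM) : EM := cnet c * u.
Let cnetM a b : cnet (a * b) = cnet a * cnet b.
Proof. exact/val_inj. Qed.
Let cnetD a b : cnet (a + b) = cnet a + cnet b.
Proof. exact/val_inj. Qed.
Let cnet1 : cnet 1 = 1.
Proof. exact/val_inj. Qed.
Let mscaleA a b u : mscale a (mscale b u) = mscale (a * b) u.
Proof. by rewrite /mscale cnetM mulrA. Qed.
Let mscale1 : left_id 1 mscale.
Proof. by move=> u; rewrite /mscale cnet1 mul1r. Qed.
Let mscaleDr : right_distributive mscale +%R.
Proof. by move=> a u v; rewrite /mscale mulrDr. Qed.
Let mscaleDl u : {morph mscale^~ u : a b / a + b}.
Proof. by move=> a b; rewrite /mscale cnetD mulrDl. Qed.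
HB.instance Definition _ :=
  GRing.Zmodule_isLmodule.Build C EM mscaleA mscale1 mscaleDr mscaleDl.
Let mscaleAl (a : C) (u v : EM) : a *: (u * v) = a *: u * v.
Proof. exact: mulrA. Qed.
HB.instance Definition _ := GRing.Lmodule_isLalgebra.Build C EM mscaleAl.
HB.instance Definition _ := GRing.Lalgebra_isComAlgebra.Build C EM.

Lemma moderate_net_scaleE (c : C) (u : EM) e x : (c *: u : EM) e x = c * u e x.
Proof. by []. Qed.

Definition negligible_nets : {pred EM} := [pred u : EM | `[< negligible_on u >]].

Let negligible_ideal : idealr_closed negligible_nets.
Proof.
split; first by apply/asboolP; exact: negligible_on0.
  by apply/asboolP; exact: negligible_on1.
move=> a u v /asboolP hu /asboolP hv; apply/asboolP.
exact: (negligible_onD oO (negligible_onM oO (moderate_netP a) hu) hv).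
Qed.
HB.instance Definition _ := isIdealr.Build EM negligible_nets negligible_ideal.

Definition colombeau : Type := {ideal_quot negligible_nets}.
HB.instance Definition _ := GRing.ComAlgebra.on colombeau.

Definition colombeau_class (u : EM) : colombeau := \pi_{ideal_quot negligible_nets}%qT u.

Definition net_pderiv (i : 'I_d) (u : EM) : EM := ModerateNet
  (asboolT (moderate_on_pderiv oO i (moderate_netP u))).

(* Well defined on classes by colombeau_pderivE. *)
Definition colombeau_pderiv (i : 'I_d) (U : colombeau) : colombeau :=
  colombeau_class (net_pderiv i (repr U)).

Lemma colombeau_pderivE i u :
  colombeau_pderiv i (colombeau_class u) = colombeau_class (net_pderiv i u).
Proof.
apply/eqP; rewrite /colombeau_pderiv /colombeau_class.
rewrite -Quotient.idealrBE; apply/asboolP => /=.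
set r := repr _.
have /asboolP hru : (r - u) \in negligible_nets.
  by rewrite Quotient.idealrBE /r reprK.
have := negligible_on_pderiv oO i hru.
by rewrite (pderiv_onB oO i (moderate_netP r) (moderate_netP u)).
Qed.
End Structure.
End Colombeau.

Section Points.
Variables (R : realType) (d : nat).

(* The Euclidean norm; the library norm on 'rV[R]_d is the sup norm. *)
Definition enorm (x : 'rV[R]_d) : R := Num.sqrt (\sum_i x 0 i ^+ 2).

Lemma enorm_ge0 x : 0 <= enorm x. Proof. exact: sqrtr_ge0. Qed.

Lemma enorm0 : enorm 0 = 0.
Proof.
by rewrite /enorm big1 ?sqrtr0// => i _; rewrite mxE expr0n.
Qed.

Lemma enormN x : enorm (- x) = enorm x.
Proof. by rewrite /enorm; congr Num.sqrt; apply: eq_bigr => i _; rewrite mxE sqrrN. Qed.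

Lemma enormD x y : enorm (x + y) <= (enorm x + enorm y) + (enorm x + enorm y).
Proof.
have s0 (z : 'rV[R]_d) : 0 <= \sum_i z 0 i ^+ 2.
  by apply: sumr_ge0 => i _; exact: sqr_ge0.
have e0 : 0 <= enorm x + enorm y by rewrite addr_ge0 ?enorm_ge0.
rewrite -[leLHS]ger0_norm ?enorm_ge0// -[leRHS]ger0_norm ?addr_ge0 ?enorm_ge0//.
rewrite -ler_sqr ?nnegrE ?normr_ge0// !real_normK ?num_real//.
rewrite sqr_sqrtr//.
have h : \sum_i (x + y) 0 i ^+ 2 <= (enorm x ^+ 2 + enorm y ^+ 2) *+ 2.
  rewrite !sqr_sqrtr// -big_split/= -sumrMnl; apply: ler_sum => i _.
  rewrite mxE -subr_ge0.
  rewrite (_ : _ - _ = (x 0 i - y 0 i) ^+ 2) ?sqr_ge0//.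
  by rewrite sqrrD sqrrB mulr2n; ring.
apply: le_trans h _; rewrite -subr_ge0.
rewrite (_ : _ - _ = enorm x ^+ 2 *+ 2 + enorm y ^+ 2 *+ 2 + (enorm x * enorm y) *+ 8).
  by rewrite !addr_ge0 ?mulrn_wge0 ?sqr_ge0 ?mulr_ge0 ?enorm_ge0.
by ring.
Qed.

Definition moderate_point_pred : {pred Eps R -> 'rV[R]_d} :=
  [pred x : Eps R -> 'rV[R]_d | `[< moderate (fun e => enorm (x e)) >]].

Let moderate_point_closed : zmod_closed moderate_point_pred.
Proof.
split=> [|x y /asboolP[M hx] /asboolP[N hy]]; apply/asboolP.
  exists 0%N; apply: for_smallT => e; rewrite expr0 invr1.
  by rewrite [X in enorm X](_ : _ = 0)// enorm0.
exists (maxn M N).+2.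
apply: for_smallS (for_smallI (@for_small_half R) (for_smallI hx hy)).
move=> e [e2 [{}hx {}hy]].
apply: le_trans (double_expV _ e2); apply: le_trans (enormD _ _) _.
rewrite enormN.
have h : enorm (x e) + enorm (y e) <= sval e ^- (maxn M N).+1.
  apply: le_trans (double_expV _ e2); apply: lerD.
    by apply: le_trans hx _; apply: expV_le; exact: leq_maxl.
  by apply: le_trans hy _; apply: expV_le; exact: leq_maxr.
exact: lerD.
Qed.

Record moderate_points := ModeratePoint {
  moderate_point :> Eps R -> 'rV[R]_d;
  _ : moderate_point \in moderate_point_pred
}.

HB.instance Definition _ := [isSub for moderate_point].
HB.instance Definition _ := [Choice of moderate_points by <:].
HB.instance Definition _ :=
  GRing.SubChoice_isSubZmodule.Build _ _ moderate_points moderate_point_closed.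

Definition negligible_points : {pred moderate_points} :=
  [pred x : moderate_points | `[< negligible (fun e => enorm (x e)) >]].

Let negligible_point_closed : zmod_closed negligible_points.
Proof.
split=> [|x y /asboolP hx /asboolP hy]; apply/asboolP.
  move=> m; apply: for_smallT => e.
  by rewrite [X in enorm X](_ : _ = 0)// enorm0 exprn_ge0// ltW// Eps_gt0.
move=> m.
apply: for_smallS (for_smallI (@for_small_half R) (for_smallI (hx m.+2) (hy m.+2))).
move=> e [e2 [{}hx {}hy]].
apply: le_trans (double_exp _ e2); apply: le_trans (enormD _ _) _.
rewrite enormN.
have h : enorm (x e) + enorm (y e) <= sval e ^+ m.+1.
  by apply: le_trans (double_exp _ e2); exact: lerD.
exact: lerD.
Qed.

HB.instance Definition _ :=
  GRing.isZmodClosed.Build _ negligible_points negligible_point_closed.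

Definition gpoint : Type := Quotient.quot negligible_points.

Definition gpoint_class (x : moderate_points) : gpoint :=
  \pi_(Quotient.quot negligible_points)%qT x.

Definition gpoints_of (K : set 'rV[R]_d) : set gpoint :=
  [set X | exists x : moderate_points,
             gpoint_class x = X /\ for_small (fun e => K (x e))].

Definition compact_gpoints (O : set 'rV[R]_d) : set gpoint :=
  \bigcup_(K in [set K | compact K /\ K `<=` O]) gpoints_of K.

Lemma compact_gpoints_neq0 (O : set 'rV[R]_d) :
  O !=set0 -> compact_gpoints O !=set0.
Proof.
move=> [a Oa].
have ma : (fun=> a) \in moderate_point_pred.
  apply/asboolP; have [a1|a1] := leP (enorm a) 1.
    by exists 0%N; apply: for_smallT => e; rewrite expr0 invr1.
  have a0 : 0 < enorm a by apply: lt_trans a1.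
  exists 1%N; apply: (@for_small_le _ _ (enorm a)^-1); first by rewrite invr_gt0.
  move=> e ea; rewrite expr1 -[leLHS]invrK lef_pV2 ?posrE ?Eps_gt0//.
  by rewrite invr_gt0.
exists (gpoint_class (ModeratePoint ma)), [set a].
  by split; [exact: compact_set1|move=> _ ->].
by exists (ModeratePoint ma); split=> //; apply: for_smallT.
Qed.

End Points.

Section GTilde.
Variables (R : realType) (d : nat) (A : set (gpoint R d)).
Local Notation C := R[i].
Local Notation E := 'rV[R]_d.
Local Notation normc := (@ComplexField.Normc.normc R).

Definition moderate_at (u : Eps R -> E -> C) : Prop :=
  (forall e, csmooth_on setT (u e)) /\
  forall (alpha : 'I_d -> nat) (X : gpoint R d), A X ->
    forall x : moderate_points R d, gpoint_class x = X ->
      moderate (fun e => normc (mderiv alpha (u e) (x e))).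

Definition negligible_at (u : Eps R -> E -> C) : Prop :=
  (forall e, csmooth_on setT (u e)) /\
  forall (alpha : 'I_d -> nat) (X : gpoint R d), A X ->
    forall x : moderate_points R d, gpoint_class x = X ->
      negligible (fun e => normc (mderiv alpha (u e) (x e))).

Let TT : set (Eps R -> set E) :=
  [set F | exists x : moderate_points R d,
     A (gpoint_class x) /\ F = fun e => [set x e]].

Let TTO F : TT F -> forall e x, F e x -> (setT : set E) x. Proof. by []. Qed.

Let oT : open (setT : set E). Proof. exact: openT. Qed.

Let moderate_atP u : moderate_at u <-> tmod setT TT u.
Proof.
split=> -[su h]; split=> //.
  move=> F [x [Ax ->]] alpha; have [N hN] := h alpha _ Ax x erefl.
  by exists N; apply: for_smallS hN => e he _ ->.
move=> alpha X AX x xX; have TTx : TT (fun e => [set x e]).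
  by exists x; rewrite xX.
have [N hN] := h _ TTx alpha.
by exists N; apply: for_smallS hN => e; apply.
Qed.

Let negligible_atP u : negligible_at u <-> tneg setT TT u.
Proof.
split=> -[su h]; split=> //.
  move=> F [x [Ax ->]] alpha m; have hN := h alpha _ Ax x erefl m.
  by apply: for_smallS hN => e he _ ->.
move=> alpha X AX x xX m; have TTx : TT (fun e => [set x e]).
  by exists x; rewrite xX.
have hN := h _ TTx alpha m.
by apply: for_smallS hN => e; apply.
Qed.

Lemma moderate_atD u v : moderate_at u -> moderate_at v -> moderate_at (u + v).
Proof.
move=> /moderate_atP hu /moderate_atP hv; apply/moderate_atP.
exact: (tmodD oT TTO hu hv).
Qed.

Lemma moderate_atN u : moderate_at u -> moderate_at (- u).
Proof. by move=> /moderate_atP hu; apply/moderate_atP; exact: (tmodN oT TTO hu). Qed.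

Lemma moderate_atM u v : moderate_at u -> moderate_at v -> moderate_at (u * v).
Proof.
move=> /moderate_atP hu /moderate_atP hv; apply/moderate_atP.
exact: (tmodM oT TTO hu hv).
Qed.

Lemma moderate_at_cst c : moderate_at (cst (cst c)).
Proof. by apply/moderate_atP; exact: (tmod_cst setT TT c). Qed.

Lemma negligible_at0 : negligible_at 0.
Proof. by apply/negligible_atP; exact: (tneg0 setT TT). Qed.

Lemma negligible_atD u v : negligible_at u -> negligible_at v -> negligible_at (u + v).
Proof.
move=> /negligible_atP hu /negligible_atP hv; apply/negligible_atP.
exact: (tnegD oT TTO hu hv).
Qed.

Lemma negligible_atM u v : moderate_at u -> negligible_at v -> negligible_at (u * v).
Proof.
move=> /moderate_atP hu /negligible_atP hv; apply/negligible_atP.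
exact: (tnegM oT TTO hu hv).
Qed.

Lemma negligible_at1 : A !=set0 -> ~ negligible_at 1.
Proof.
move=> [X AX] /negligible_atP; apply: (@tneg1 _ _ _ _ (fun e => [set repr X e])).
  by exists (repr X); split=> //; rewrite /gpoint_class reprK.
by move=> e; exists (repr X e).
Qed.

Definition pderiv_at i (u : Eps R -> E -> C) : Eps R -> E -> C :=
  fun e => cpartial i (u e).

Lemma moderate_at_pderiv i u : moderate_at u -> moderate_at (pderiv_at i u).
Proof.
by move=> /moderate_atP hu; apply/moderate_atP; exact: (tmod_partial oT TTO i hu).
Qed.

Lemma negligible_at_pderiv i u : negligible_at u -> negligible_at (pderiv_at i u).
Proof.
by move=> /negligible_atP hu; apply/negligible_atP; exact: (tneg_partial oT TTO i hu).
Qed.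

Lemma pderiv_atB i u v : moderate_at u -> moderate_at v ->
  pderiv_at i (u - v) = pderiv_at i u - pderiv_at i v.
Proof.
move=> [su _] [sv _]; apply/funext => e; apply/funext => x.
have xT : x \in (setT : set E) by exact: mem_set.
rewrite /pderiv_at/cpartial.
have -> := cpartialsD [:: i] oT (su e) (csmooth_onN oT (sv e)) xT.
by rewrite /GRing.add/= (cpartialsN [:: i] oT (sv e) xT).
Qed.

Section Structure.
Variable A0 : A !=set0.

Definition moderate_at_pred of A !=set0 : {pred Eps R -> E -> C} :=
  [pred u | `[< moderate_at u >]].

Let moderate_closed : subring_closed (moderate_at_pred A0).
Proof.
split=> [|u v /asboolP hu /asboolP hv|u v /asboolP hu /asboolP hv]; apply/asboolP.
- exact: (moderate_at_cst 1).
- by apply: moderate_atD => //; exact: moderate_atN.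
- exact: moderate_atM.
Qed.

Record moderate_gnets := ModerateGNet {
  moderate_gnet :> Eps R -> E -> C;
  _ : moderate_gnet \in moderate_at_pred A0
}.
Local Notation EM := moderate_gnets.

HB.instance Definition _ := [isSub for moderate_gnet].
HB.instance Definition _ := [Choice of EM by <:].
HB.instance Definition _ :=
  GRing.SubChoice_isSubComPzRing.Build _ _ EM moderate_closed.

Lemma moderate_gnetP (u : EM) : moderate_at u.
Proof. by case: u => u /= /asboolP. Qed.

Let one_neq0 : (1 : EM) != 0.
Proof.
apply/eqP => /(congr1 val) h; apply: (negligible_at1 A0).
have -> : 1 = 0 :> (Eps R -> E -> C) by exact: h.
exact: negligible_at0.
Qed.
HB.instance Definition _ := GRing.PzSemiRing_isNonZero.Build EM one_neq0.

Let cnet (c : C) : EM := ModerateGNet (asboolT (moderate_at_cst c)).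

Let mscale (c : C) (u : EM) : EM := cnet c * u.
Let cnetM a b : cnet (a * b) = cnet a * cnet b.
Proof. exact/val_inj. Qed.
Let cnetD a b : cnet (a + b) = cnet a + cnet b.
Proof. exact/val_inj. Qed.
Let cnet1 : cnet 1 = 1.
Proof. exact/val_inj. Qed.
Let mscaleA a b u : mscale a (mscale b u) = mscale (a * b) u.
Proof. by rewrite /mscale cnetM mulrA. Qed.
Let mscale1 : left_id 1 mscale.
Proof. by move=> u; rewrite /mscale cnet1 mul1r. Qed.
Let mscaleDr : right_distributive mscale +%R.
Proof. by move=> a u v; rewrite /mscale mulrDr. Qed.
Let mscaleDl u : {morph mscale^~ u : a b / a + b}.
Proof. by move=> a b; rewrite /mscale cnetD mulrDl. Qed.
HB.instance Definition _ :=
  GRing.Zmodule_isLmodule.Build C EM mscaleA mscale1 mscaleDr mscaleDl.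
Let mscaleAl (a : C) (u v : EM) : a *: (u * v) = a *: u * v.
Proof. exact: mulrA. Qed.
HB.instance Definition _ := GRing.Lmodule_isLalgebra.Build C EM mscaleAl.
HB.instance Definition _ := GRing.Lalgebra_isComAlgebra.Build C EM.

Lemma moderate_gnet_scaleE (c : C) (u : EM) e x : (c *: u : EM) e x = c * u e x.
Proof. by []. Qed.

Definition negligible_gnets : {pred EM} := [pred u : EM | `[< negligible_at u >]].

Let negligible_ideal : idealr_closed negligible_gnets.
Proof.
split; first by apply/asboolP; exact: negligible_at0.
  by apply/asboolP; exact: negligible_at1.
move=> a u v /asboolP hu /asboolP hv; apply/asboolP.
exact: (negligible_atD (negligible_atM (moderate_gnetP a) hu) hv).
Qed.
HB.instance Definition _ := isIdealr.Build EM negligible_gnets negligible_ideal.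

Definition gtilde : Type := {ideal_quot negligible_gnets}.
HB.instance Definition _ := GRing.ComAlgebra.on gtilde.

Definition gtilde_class (u : EM) : gtilde := \pi_{ideal_quot negligible_gnets}%qT u.

Definition gnet_pderiv (i : 'I_d) (u : EM) : EM :=
  ModerateGNet (asboolT (moderate_at_pderiv i (moderate_gnetP u))).

(* Well defined on classes by gtilde_pderivE. *)
Definition gtilde_pderiv (i : 'I_d) (U : gtilde) : gtilde :=
  gtilde_class (gnet_pderiv i (repr U)).

Lemma gtilde_pderivE i u :
  gtilde_pderiv i (gtilde_class u) = gtilde_class (gnet_pderiv i u).
Proof.
apply/eqP; rewrite /gtilde_pderiv /gtilde_class.
rewrite -Quotient.idealrBE; apply/asboolP => /=.
set r := repr _.
have /asboolP hru : (r - u) \in negligible_gnets.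
  by rewrite Quotient.idealrBE /r reprK.
have := negligible_at_pderiv i hru.
by rewrite (pderiv_atB i (moderate_gnetP r) (moderate_gnetP u)).
Qed.

End Structure.
End GTilde.

(* Main.v *)
Require Import Defs.
From HB Require Import structures.
From mathcomp Require Import all_boot all_order all_algebra.
From mathcomp Require Import all_classical all_reals all_analysis.
From mathcomp Require Import ring.
From mathcomp Require Import complex generic_quotient ring_quotient.

Set Implicit Arguments.
Unset Strict Implicit.
Unset Printing Implicit Defensive.

Import Order.TTheory GRing.Theory Num.Theory.
Import numFieldNormedType.Exports.

Local Open Scope classical_set_scope.
Local Open Scope ring_scope.

(* Cutting off. A smooth net v on Omega is turned into a net on R^d by
   multiplying v_e with a cutoff function equal to 1 near
     core e = {x | |x| <= 1/e and the ball of radius e around x lies in Omega}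
   and vanishing near the complement of Omega. These compact sets exhaust Omega
   as e tends to 0, so near any compact K the net is unchanged for small e; this
   gives surjectivity.

   Points versus uniform bounds. If x_e maximizes |d^alpha u_e| on a compact K,
   then the growth of d^alpha u_e at the compactly supported point [x_e] is its
   growth on K. Conversely all representatives of a compactly supported point
   lie in some core r for small e. Hence a net on R^d is moderate (negligible)
   at the compactly supported points iff its restriction is moderate
   (negligible) on Omega; this gives well-definedness and injectivity. *)

(** * A criterion for smoothness *)

Section Smoothness.
Variables (R : realType) (d : nat).
Local Notation E := 'rV[R]_d.
Local Notation ev i := (delta_mx 0 i : E).
Implicit Types (f g : E -> R) (O : set E).

(** The condition that [smooth_on] imposes on each iterated derivative, isolated at one point so
    that the sum and product rules apply before any smoothness is known. *)
Definition regular_at f x := {for x, continuous f} /\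
  forall i, derivable f x (ev i).

Lemma regular_atD f g x : regular_at f x -> regular_at g x -> regular_at (f + g) x.
Proof.
move=> [cf df] [cg dg]; split; first exact: continuousD.
by move=> i; apply: derivableD.
Qed.

Lemma regular_atM f g x : regular_at f x -> regular_at g x -> regular_at (f * g) x.
Proof.
move=> [cf df] [cg dg]; split; first exact: continuousM.
by move=> i; apply: derivableM.
Qed.

Lemma partial_atD f g x i : regular_at f x -> regular_at g x ->
  partial i (f + g) x = partial i f x + partial i g x.
Proof. by move=> [_ df] [_ dg]; rewrite /partial deriveD. Qed.

Lemma partial_atM f g x i : regular_at f x -> regular_at g x ->
  partial i (f * g) x = partial i f x * g x + f x * partial i g x.
Proof.
move=> [_ df] [_ dg]; rewrite /partial deriveM// addrC /GRing.scale/=.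
by rewrite [X in X + _]mulrC.
Qed.

Lemma smooth_regular O f x : smooth_on O f -> O x -> regular_at f x.
Proof. by move=> sf Ox; exact: (sf [::]). Qed.

Lemma regular_at_eq O f g x : open O -> {in O, f =1 g} -> O x ->
  regular_at f x -> regular_at g x.
Proof.
move=> oO fg Ox [cf df].
have fgx : \forall y \near x, f y = g y.
  have : nbhs x O by apply: open_nbhs_nbhs.
  by apply: filterS => y Oy; apply: fg; exact: mem_set.
split; last by move=> i; apply: near_eq_derivable (df i).
have /= gx := fg x (mem_set Ox).
move=> A; rewrite -gx => /cf fA.
rewrite nbhs_simpl/=; near=> y.
by rewrite /= -(near fgx y)//; near: y; exact: fA.
Unshelve. all: by end_near.
Qed.

Inductive smooth_span O (I : Type) (G : I -> E -> R) : (E -> R) -> Prop :=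
| span_gen k : smooth_span O G (G k)
| span_smooth a : smooth_on O a -> smooth_span O G a
| span_add f g : smooth_span O G f -> smooth_span O G g -> smooth_span O G (f + g)
| span_mul f g : smooth_span O G f -> smooth_span O G g -> smooth_span O G (f * g).

(* If the partial derivatives of the generators stay, on O, in the algebra
   they generate over the smooth functions, this algebra is closed under
   differentiation, hence consists of smooth functions. *)
Lemma smooth_on_gen O (I : Type) (G : I -> E -> R) : open O ->
  (forall k x, O x -> regular_at (G k) x) ->
  (forall k i, exists f, smooth_span O G f /\ {in O, partial i (G k) =1 f}) ->
  forall k, smooth_on O (G k).
Proof.
move=> oO rG dG.
have rspan f x : smooth_span O G f -> O x -> regular_at f x.
  move=> sf Ox; elim: sf => {f} [k|a sa|f g _ rf _ rg|f g _ rf _ rg].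
  - exact: rG.
  - exact: smooth_regular sa Ox.
  - exact: regular_atD.
  - exact: regular_atM.
have dspan f i : smooth_span O G f ->
    exists f', smooth_span O G f' /\ {in O, partial i f =1 f'}.
  elim=> {f} [k|a sa|f g sf [f' [sf' ff']] sg [g' [sg' gg']]
    |f g sf [f' [sf' ff']] sg [g' [sg' gg']]].
  - exact: dG.
  - by exists (partial i a); split=> //; apply: span_smooth; exact: smooth_partial.
  - exists (f' + g'); split; first exact: span_add.
    move=> x xO; have Ox := set_mem xO.
    by rewrite partial_atD ?ff' ?gg'//; exact: rspan.
  - exists (f' * g + f * g'); split.
      by apply: span_add; exact: span_mul.
    move=> x xO; have Ox := set_mem xO.
    by rewrite partial_atM ?ff' ?gg'//; exact: rspan.
have pspan s f : smooth_span O G f ->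
    exists f', smooth_span O G f' /\ {in O, partials s f =1 f'}.
  move=> sf; elim: s => [|i s [f' [sf' ff']]]; first by exists f.
  have [f'' [sf'' ff'']] := dspan f' i sf'.
  exists f''; split=> // x xO.
  by rewrite /= (partial_eq i oO ff' xO) ff''.
move=> k s x Ox.
have [f' [sf' ff']] := pspan s _ (span_gen O G k).
apply: (@regular_at_eq O f' _ x oO _ Ox); last exact: rspan.
by move=> y yO; rewrite ff'.
Qed.

(** A single generator 1/f suffices: its partial derivatives are [- partial i f] times the square of
    1/f, which is again in the span. *)
Lemma smooth_onV O f : open O -> smooth_on O f -> (forall x, O x -> f x != 0) ->
  smooth_on O (fun x => (f x)^-1).
Proof.
move=> oO sf f0.
pose G (_ : unit) x := (f x)^-1.
have rf x : O x -> regular_at f x by exact: smooth_regular.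
apply: (@smooth_on_gen O unit G oO _ _ tt) => [[] x Ox|[] i].
  split; first by apply: continuousV; [exact: f0|exact: (rf x Ox).1].
  by move=> i; apply: derivableV; [exact: f0|exact: (rf x Ox).2].
exists ((cst (-1) * partial i f) * (G tt * G tt)); split.
  apply: span_mul; last by apply: span_mul; exact: (span_gen O G tt).
  apply: span_smooth; apply: smooth_onM => //; last exact: smooth_partial.
  exact: smooth_on_cst.
move=> x /set_mem Ox; rewrite /partial deriveV; last 2 first.
- exact: f0.
- exact: (rf x Ox).2.
by rewrite !fctE /G mulN1r /GRing.scale/= -exprVn expr2 mulNr mulrC mulNr.
Qed.

Lemma derive_lineE f x v :
  (derivable f x v = derivable (fun r : R => f (x + r *: v)) 0 1) *
  ('D_v f x = 'D_1 (fun r : R => f (x + r *: v)) 0).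
Proof.
have e : (fun h : R => h^-1 *: ((f \o shift x) (h *: v) - f x)) =
  fun h : R => h^-1 *: (((fun r : R => f (x + r *: v)) \o shift 0) (h *: 1)
                       - f (x + 0 *: v)).
  apply/funext => h /=; rewrite addr0 scale0r addr0 [h *: 1]mulr1.
  by rewrite [x + _]addrC.
by rewrite /derivable /derive e.
Qed.

(** On the line through [x] along [v] this becomes the one-variable chain rule, so derivability of
    [f] along [v] is enough. *)
Lemma is_derive_comp_line (h : R -> R) f x v (a b : R) :
  is_derive (f x) 1 h a -> is_derive x v f b -> is_derive x v (h \o f) (a * b).
Proof.
move=> ha [df fb].
have hb : is_derive (0 : R) 1 (fun r : R => f (x + r *: v)) b.
  by split; rewrite -derive_lineE.
have : is_derive (0 : R) 1 (h \o (fun r : R => f (x + r *: v))) (a * b).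
  by apply: is_derive1_comp; rewrite scale0r addr0.
by move=> [? <-]; split; rewrite derive_lineE.
Qed.

Lemma smooth_on_coord O (i : 'I_d) : smooth_on O (fun x : E => x 0 i).
Proof.
have dc (x : E) (j : 'I_d) :
    is_derive x (ev j) (fun x : E => x 0 i) ((ev j) 0 i).
  have e h : h != 0 -> h^-1 *: (((fun x : E => x 0 i) \o shift x) (h *: ev j) - x 0 i)
       = ev j 0 i.
    by move=> h0; rewrite /= !mxE addrK /GRing.scale/= mulKf.
  have c : h^-1 *: (((fun x : E => x 0 i) \o shift x) (h *: ev j) - x 0 i)
      @[h --> 0^'] --> ev j 0 i.
    apply: (@cvg_near_cst _ _ _ _ _) => //.
    by near=> h; apply: e; near: h; exact: nbhs_dnbhs_neq.
  split; first by apply/cvg_ex; exists (ev j 0 i).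
  exact: cvg_lim c.
have pc j : partial j (fun x : E => x 0 i) = cst ((ev j) 0 i).
  by apply/funext => x; rewrite /partial derive_val.
move=> s x Ox; case/lastP: s => [|s j].
  split; last by move=> j; have [] := dc x j.
  exact: coord_continuous.
by rewrite partials_rcons pc; exact: (@smooth_on_cst R d O _ s x Ox).
Unshelve. all: by end_near.
Qed.

End Smoothness.

(** * Flat functions *)

Section Flat.
Variable R : realType.
Implicit Types (k : nat) (t h : R).

(** For [k = 0] this is the classical smooth function exp(-1/t), extended by zero. Differentiation
    creates the factors t^(-k), so the family contains its own derivatives up to linear
    combinations. *)
Definition flat k t : R := if 0 < t then t^-1 ^+ k * expR (- t^-1) else 0.

Lemma flat_ge0 k t : 0 <= flat k t.
Proof.
rewrite /flat; case: ifPn => // t0.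
by rewrite mulr_ge0 ?expR_ge0// exprn_ge0// invr_ge0 ltW.
Qed.

Lemma flat_gt0 k t : 0 < t -> 0 < flat k t.
Proof. by move=> t0; rewrite /flat t0 mulr_gt0 ?expR_gt0// exprn_gt0 ?invr_gt0. Qed.

Lemma flat_le0 k t : t <= 0 -> flat k t = 0.
Proof. by rewrite /flat ltNge => ->. Qed.

(** The exponential series bounds exp(1/t) below by t^(-(k+1)) / (k+1)!. One power of 1/t more than
    [flat k] contains leaves a factor [t], which gives the limit 0 at 0. *)
Lemma flat_le k t : 0 <= t -> flat k t <= k.+1`!%:R * t.
Proof.
rewrite le_eqVlt => /orP[/eqP<-|t0]; first by rewrite flat_le0 ?mulr0.
have ti : 0 < t^-1 by rewrite invr_gt0.
have f0 : 0 < k.+1`!%:R :> R by rewrite ltr0n fact_gt0.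
rewrite /flat t0 expRN ler_pdivrMr ?expR_gt0//.
have := expR_ge1Dxn k (ltW ti); move: (expR t^-1) => e he.
have {}he : t^-1 ^+ k.+1 <= k.+1`!%:R * e.
  by rewrite -ler_pdivrMl// mulrC (le_trans _ he)// lerDr ler01.
rewrite mulrAC -ler_pdivrMr//; move: he; rewrite exprS.
by rewrite [X in X <= _]mulrC.
Qed.

Lemma flat_cvg0 k : flat k h @[h --> (0 : R)] --> (0 : R).
Proof.
apply/cvgr0Pnorm_le => e e0.
have f0 : 0 < k.+1`!%:R :> R by rewrite ltr0n fact_gt0.
exists (e / k.+1`!%:R) => /=; first by rewrite divr_gt0.
move=> h /=; rewrite sub0r normrN => he.
rewrite ger0_norm ?flat_ge0//; have [h0|h0] := leP h 0.
  by rewrite flat_le0// ltW.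
apply: le_trans (flat_le k (ltW h0)) _; rewrite mulrC -ler_pdivlMr//.
by rewrite ltW// -[ltLHS]gtr0_norm.
Qed.

Lemma flatS k t : flat k.+1 t = t^-1 * flat k t.
Proof. by rewrite /flat; case: ifP => _; rewrite ?mulr0// exprS mulrA. Qed.

Lemma is_derive_flat k t : is_derive t 1 (flat k) (flat k.+2 t - k%:R * flat k.+1 t).
Proof.
have [t0|t0|->] := ltgtP t 0.
- rewrite !flat_le0 ?ltW// mulr0 subr0.
  have e : \forall y \near t, cst 0 y = flat k y.
    by near=> y; rewrite flat_le0// ltW//; near: y; exact: lt_nbhsl.
  split; first by apply: near_eq_derivable e _; exact: derivable_cst.
  by rewrite -(near_eq_derive _ e) derive_cst.
- pose g := (fun y : R => y^-1 ^+ k) * (expR \o (fun y : R => - y^-1)).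
  have e : \forall y \near t, g y = flat k y.
    by near=> y; rewrite /g /flat/= ifT//; near: y; exact: lt_nbhsr.
  have dV : is_derive t 1 (fun y : R => y^-1) (- t ^- 2).
    have := @is_deriveV R id t 1 1 (lt0r_neq0 t0) (is_derive_id _ _).
    by rewrite /GRing.scale/= mulr1.
  have dX : is_derive t 1 (fun y : R => y^-1 ^+ k) (k%:R * t^-1 ^+ k.-1 * - t ^- 2).
    by have := is_deriveX k dV; rewrite exprfctE.
  have dN : is_derive t 1 (fun y : R => - y^-1) (t ^- 2).
    by have := is_deriveN dV; rewrite opprK.
  have dE : is_derive t 1 (expR \o (fun y : R => - y^-1)) (expR (- t^-1) * t ^- 2).
    exact: is_derive1_comp.
  have [dg gE] := is_deriveM dX dE.
  split; first exact: near_eq_derivable e dg.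
  rewrite -(near_eq_derive _ e) gE /flat t0 /GRing.scale/=.
  rewrite -exprVn; case: k {g e dX dg gE} => [|k].
    by rewrite !mul0r subr0 mulr0 addr0 expr0 mul1r mulrC.
  by rewrite /= !exprS; ring.
- rewrite !flat_le0 ?mulr0 ?subr0//.
  (* At 0 the difference quotient of [flat k] is exactly [flat k.+1], which tends to 0. *)
  have c : h^-1 *: ((flat k \o shift 0) (h *: 1) - flat k 0) @[h --> (0 : R)^'] --> (0 : R).
    rewrite (_ : (fun h => _) = flat k.+1).
      by apply: cvg_within_filter; exact: flat_cvg0.
    apply/funext => h /=; rewrite (@flat_le0 k 0)// subr0 addr0 flatS.
    by rewrite [h *: 1]mulr1.
  by split; [apply/cvg_ex; exists 0|exact: cvg_lim c].
Unshelve. all: by end_near.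
Qed.

Variable d : nat.
Implicit Types (f : 'rV[R]_d -> R) (O : set 'rV[R]_d).

(** All orders serve as generators at once, since the derivatives of [flat k \o f] involve the
    orders [k.+1] and [k.+2]. *)
Lemma smooth_on_flat O f k : open O -> smooth_on O f -> smooth_on O (flat k \o f).
Proof.
move=> oO sf; apply: (@smooth_on_gen R d O nat (fun k => flat k \o f)) => // {}k.
  move=> x Ox; have [cf df] := smooth_regular sf Ox; split.
    apply: continuous_comp; first exact: cf.
    apply: differentiable_continuous; apply/derivable1_diffP.
    by have [] := is_derive_flat k (f x).
  move=> i; have := is_derive_comp_line (is_derive_flat k (f x)) (derivableP (df i)).
  by case.
move=> i; exists ((flat k.+2 \o f + cst (- k%:R) * (flat k.+1 \o f)) * partial i f).
split.
  apply: span_mul; last by apply: span_smooth; exact: smooth_partial.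
  apply: span_add; first exact: (span_gen O (fun k => flat k \o f)).
  apply: span_mul; last exact: (span_gen O (fun k => flat k \o f)).
  by apply: span_smooth; exact: smooth_on_cst.
move=> x /set_mem Ox; have [_ df] := smooth_regular sf Ox.
have [_ e] := is_derive_comp_line (is_derive_flat k (f x)) (derivableP (df i)).
by rewrite /partial e !fctE mulNr.
Qed.

End Flat.

(** * Cutoff functions and compact exhaustion *)

Section Cutoff.
Variables (R : realType) (d : nat).
Local Notation E := 'rV[R]_d.
Implicit Types (O K : set E) (a x : E) (r : R).

(** A product over the coordinates fits the sup norm: for [0 < r] it is positive exactly on the cube
    [ball a r]. *)
Definition bump a r : E -> R :=
  \prod_(i < d) (flat 0 \o (cst (r ^+ 2) -
    ((fun x => x 0 i) - cst (a 0 i)) * ((fun x => x 0 i) - cst (a 0 i)))).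

Lemma bumpE a r x : bump a r x = \prod_(i < d) flat 0 (r ^+ 2 - (x 0 i - a 0 i) ^+ 2).
Proof. by rewrite /bump fct_prodE; apply: eq_bigr => i _; rewrite !fctE expr2. Qed.

Lemma smooth_bump a r : smooth_on setT (bump a r).
Proof.
have oT := @openT E.
apply: (@big_ind _ (smooth_on (setT : set E))) => [|f g|i _].
- exact: (@smooth_on_cst R d setT 1).
- exact: smooth_onM.
apply: smooth_on_flat => //; apply: smooth_onD => //; first exact: smooth_on_cst.
apply: smooth_onN => //.
have sc : smooth_on (setT : set E) ((fun x => x 0 i) - cst (a 0 i)).
  apply: smooth_onD => //; first exact: smooth_on_coord.
  by apply: smooth_onN => //; exact: smooth_on_cst.
exact: smooth_onM.
Qed.

Lemma bump_ge0 a r x : 0 <= bump a r x.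
Proof. by rewrite bumpE; apply: prodr_ge0 => i _; exact: flat_ge0. Qed.

Lemma bump_gt0 a r x : ball a r x -> 0 < bump a r x.
Proof.
move=> [r0 /(_ 0) ax]; rewrite bumpE; apply: prodr_gt0 => i _; apply: flat_gt0.
have := ax i; rewrite -ball_normE/= distrC subr_gt0 => axi.
by rewrite -real_normK ?num_real// ltr_sqr ?nnegrE ?normr_ge0// ltW.
Qed.

Lemma bump_eq0 a r x : 0 < r -> ~ ball a r x -> bump a r x = 0.
Proof.
move=> r0; apply: contra_notP => /eqP; rewrite bumpE => b0; split=> // i j.
rewrite ord1 -ball_normE/= distrC ltNge; apply/negP => rx.
have /prodf_neq0 := b0 => /(_ j isT); rewrite flat_le0 ?eqxx// subr_le0.
by rewrite -[leRHS]real_normK ?num_real// ler_sqr ?nnegrE ?normr_ge0// ltW.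
Qed.

Lemma near_sum_eq0 (F : E -> E -> R) (s : seq E) x :
  (forall a, a \in s -> \forall y \near x, F a y = 0) ->
  \forall y \near x, (\sum_(a <- s) F a) y = 0.
Proof.
elim: s => [|a s IH] h; first by near=> y; rewrite big_nil.
have {}IH : \forall y \near x, (\sum_(a <- s) F a) y = 0.
  by apply: IH => b bs; apply: h; rewrite inE bs orbT.
have ha : \forall y \near x, F a y = 0 by apply: h; rewrite mem_head.
near=> y; have ay : F a y = 0 by near: y.
have sy : (\sum_(a <- s) F a) y = 0 by near: y.
by rewrite big_cons -[LHS]/(F a y + (\sum_(a <- s) F a) y) ay sy addr0.
Unshelve. all: by end_near.
Qed.

Lemma exists_bump_sum O K : open O -> compact K -> K `<=` O ->
  exists f : E -> R, [/\ smooth_on setT f, forall x, 0 <= f x,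
    forall x, K x -> 0 < f x & forall x, ~ O x -> \forall y \near x, f y = 0].
Proof.
move=> oO cK KO.
(* With the ball of twice the radius inside [O], a point within [r a] of the complement of [O] is
   outside [ball a (r a)]. Hence each bump vanishes near the complement, not only on it. The radius
   1 for centres outside [O] is a dummy value. *)
have /choice[r hr] : forall a, exists r, 0 < r /\ (O a -> ball a (r + r) `<=` O).
  move=> a; have [Oa|nOa] := pselect (O a); last by exists 1.
  have : nbhs a O by apply: open_nbhs_nbhs.
  move=> /nbhs_ballP[r/= r0 rO]; exists (r / 2); split; first by rewrite divr_gt0.
  by rewrite -splitr.
move: cK; rewrite compact_cover => /(_ E O (fun a => ball a (r a))) [].
- by move=> a Oa; exact: ball_open.
- by move=> x /KO Ox; exists x => //; apply: ballxx; case: (hr x).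
move=> D DO KD; exists (\sum_(a <- finmap.enum_fset D) bump a (r a)); split.
- apply: (@big_ind _ (smooth_on (setT : set E))) => [|f g|a _].
  + exact: (@smooth_on_cst R d setT 0).
  + by apply: smooth_onD; exact: openT.
  + exact: smooth_bump.
- by move=> x; rewrite fct_sumE; apply: sumr_ge0 => a _; exact: bump_ge0.
- move=> x Kx; have [a /= aD ax] := KD x Kx.
  rewrite fct_sumE (big_rem a)//=; apply: ltr_wpDr.
    by apply: sumr_ge0 => b _; exact: bump_ge0.
  exact: bump_gt0.
- move=> x nOx; apply: near_sum_eq0 => a aD.
  have Oa : O a by exact/set_mem/DO.
  have [ra0 /(_ Oa) raO] := hr a.
  have : \forall y \near x, ball x (r a) y by exact: nbhsx_ballx.
  apply: filterS => y xy; apply: bump_eq0 => // ay; apply/nOx/raO.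
  by apply: ball_triangle ay _; exact: ball_sym.
Qed.

(** Take [f] from [exists_bump_sum], a level [c] between 0 and its minimum on [K], and the quotient
    g / (g + h) built below. The denominator never vanishes, because [g] is positive where [f] is
    and [h] is positive where [f < c]. The quotient is 1 where [f > c] and 0 where [f = 0]. *)
Lemma exists_cutoff O K : open O -> compact K -> K `<=` O ->
  exists chi : E -> R, [/\ smooth_on setT chi,
    forall x, K x -> \forall y \near x, chi y = 1 &
    forall x, ~ O x -> \forall y \near x, chi y = 0].
Proof.
move=> oO cK KO; have [K0|/set0P K0] := eqVneq K set0.
  exists (cst 0); split=> [|x|x _]; first exact: smooth_on_cst.
    by rewrite K0.
  by near=> y.
have [f [sf f0 fK fO]] := exists_bump_sum oO cK KO.
have oT := @openT E.
have cf : continuous f by move=> x; exact: (sf [::] x I).1.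
have [z zK fz] := compact_EVT_min K0 cK (continuous_subspaceT cf).
have c0 : 0 < f z by apply: fK; exact: set_mem.
(* Half the minimum, so that [c < f] holds on a neighbourhood of [K]. *)
pose c := f z / 2.
have c0' : 0 < c by rewrite divr_gt0.
pose g := flat 0 \o f; pose h := flat 0 \o (cst c - f).
have sg : smooth_on setT g by exact: smooth_on_flat.
have sh : smooth_on setT h.
  have sN := smooth_onD oT (@smooth_on_cst R d setT c) (smooth_onN oT sf).
  exact: (smooth_on_flat 0 oT sN).
have gh x : (g + h) x != 0.
  rewrite gt_eqF// /g /h !fctE/=; have [fx|fx] := ltP 0 (f x).
    by rewrite ltr_wpDr ?flat_gt0 ?flat_ge0.
  by rewrite ltr_wpDl ?flat_ge0// flat_gt0// subr_gt0 (le_lt_trans fx).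
exists (g * (fun x => ((g + h) x)^-1)); split.
- exact: (smooth_onM oT sg (smooth_onV oT (smooth_onD oT sg sh) (fun x _ => gh x))).
- move=> x Kx.
  have cfx : c < f x.
    apply: lt_le_trans (fz x (mem_set Kx)).
    by rewrite /c ltr_pdivrMr// ltr_pMr// ltr1n.
  have : \forall y \near x, c < f y.
    have cfx' : f @ x --> f x := cf x.
    by have H := cvgr_gt (f x) cfx' c cfx; exact: H.
  apply: filterS => y cy.
  have hy : h y = 0 by rewrite /h !fctE flat_le0// subr_le0 ltW.
  have := gh y; rewrite !fctE hy addr0 => gy.
  by rewrite mulfV.
- move=> x /fO; apply: filterS => y fy.
  by rewrite !fctE /g/= fy flat_le0// mul0r.
Unshelve. all: by end_near.
Qed.

End Cutoff.

(** * Exhaustion of an open set by compact sets *)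

Section Core.
Variables (R : realType) (d : nat) (O : set 'rV[R]_d).
Local Notation E := 'rV[R]_d.
Implicit Types (K : set E) (x y : E) (r : R).

Definition core r : set E := [set x | `|x| <= r^-1 /\ ball x r `<=` O].

Lemma core_sub r : 0 < r -> core r `<=` O.
Proof. by move=> r0 x [_]; apply; exact: ballxx. Qed.

Lemma core_compact r : 0 < r -> compact (core r).
Proof.
move=> r0; apply: bounded_closed_compact.
  exists r^-1; split; first exact: num_real.
  by move=> s rs x [xr _]; exact: le_trans xr (ltW rs).
(* The ball around [x] lies in [O] iff [x] avoids the open [r]-neighbourhood of the complement of
   [O], which is a closed condition. *)
rewrite (_ : core r = [set x | `|x| <= r^-1] `&` ~` (\bigcup_(y in ~` O) ball y r)).
  apply: closedI.
    apply: (@closed_comp _ _ (fun x : E => `|x|) [set t | t <= r^-1]).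
      by move=> x _; exact: norm_continuous.
    exact: closed_le.
  by apply: open_closedC; apply: bigcup_open => y _; exact: ball_open.
apply/seteqP; split=> x [xr xO]; split=> //.
  by move=> [y nOy yx]; apply/nOy/xO; exact: ball_sym.
by move=> y xy; apply: contrapT => nOy; apply: xO; exists y => //; exact: ball_sym.
Qed.

Lemma core_le r s : 0 < r -> r <= s -> core s `<=` core r.
Proof.
move=> r0 rs x [xs xO]; split; last by move=> y /(le_ball rs); exact: xO.
by apply: le_trans xs _; rewrite lef_pV2// posrE// (lt_le_trans r0).
Qed.

Lemma core_near r x y : 0 < r < 1 -> core r x -> `|x - y| < r / 2 -> core (r / 2) y.
Proof.
move=> /andP[r0 r1] [xr xO] xy.
have r20 : 0 < r / 2 by rewrite divr_gt0.
split.
  rewrite -[y](subKr x) (le_trans (ler_normB _ _))//.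
  rewrite invf_div mulrC mulr_natr mulr2n lerD// (le_trans (ltW xy))//.
  (* Since r < 1, the error r/2 is at most 1 and hence at most 1/r, so |y| is bounded by 2/r. *)
  have r1' : 1 <= r^-1 by rewrite -[leLHS]invr1 lef_pV2 ?posrE// ltW.
  by apply: le_trans r1'; rewrite ler_pdivrMr// mul1r ltW// (lt_trans r1)// ltr1n.
move=> z yz; apply: xO; rewrite [r]splitr; apply: ball_triangle yz.
by rewrite -ball_normE.
Qed.

(** Each point of [O] has a neighbourhood contained in [core O r] for all small [r]; the
    near-covering form of compactness makes [r] uniform over [K]. *)
Lemma compact_sub_core K : open O -> compact K -> K `<=` O ->
  exists2 r, 0 < r < 1 & K `<=` core r.
Proof.
move=> oO cK KO.
have : \forall r \near (0 : R)^'+, K `<=` core r.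
  apply: (iffLR (compact_near_coveringP K) cK) => x Kx.
  have : nbhs x O by apply: open_nbhs_nbhs => //; split=> //; exact: KO.
  move=> /nbhs_ballP[r/= r0 rO].
  (* For [t < s] and [y] close to [x], the second bound gives |y| <= |x| + 1 <= 1/t, and the first
     keeps [ball y t] inside [ball x r]. *)
  pose s := Num.min (r / 2) (`|x| + 1)^-1.
  have s0 : 0 < s by rewrite lt_min divr_gt0//= invr_gt0 ltr_wpDl.
  exists (ball x (Num.min (r / 2) 1), [set t | 0 < t < s]).
    split=> /=.
      by apply: nbhsx_ballx; rewrite lt_min divr_gt0//=.
    near=> t; apply/andP; split; near: t; [exact: nbhs_right_gt|exact: nbhs_right_lt].
  move=> [y t] [/= xy /andP[t0]]; rewrite lt_min => /andP[tr tx]; split.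
    have yx : `|y| <= `|x| + 1.
      rewrite -[y](subKr x) (le_trans (ler_normB _ _))// lerD2l ltW//.
      by move: xy; rewrite -ball_normE/= lt_min => /andP[].
    apply: le_trans yx _; rewrite -[leLHS]invrK lef_pV2 ?posrE ?invr_gt0 ?ltr_wpDl//.
    exact: ltW.
  move=> z yz; apply: rO; rewrite [r]splitr.
  have xy' : ball x (r / 2) y by apply: le_ball xy; rewrite ge_min lexx.
  by apply: ball_triangle xy' _; apply: le_ball yz; exact: ltW.
move=> h; near (0 : R)^'+ => r.
exists r; last by near: r.
by apply/andP; split; near: r; [exact: nbhs_right_gt|exact: nbhs_right_lt].
Unshelve. all: by end_near.
Qed.

End Core.

(** * Compactly supported points and uniform bounds *)

Section CompactlySupportedPoints.
Variables (R : realType) (d : nat) (O : set 'rV[R]_d).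
Local Notation E := 'rV[R]_d.
Local Notation C := R[i].
Local Notation normc := (@ComplexField.Normc.normc R).
Implicit Types (K : set E) (x : E).

Lemma le_coord_norm x (i : 'I_d) : `|x 0 i| <= `|x|.
Proof.
rewrite -[leRHS]/(mx_norm x) mx_normrE.
exact: (le_bigmax 0 (fun ij : 'I_1 * 'I_d => `|x ij.1 ij.2|) (0, i)).
Qed.

(** Generalized points are measured in the Euclidean norm, balls and boundedness in the sup norm;
    this lemma and [norm_le_enorm] pass between the two. *)
Lemma enorm_le x (M : R) : `|x| <= M -> enorm x <= Num.sqrt (\sum_(i < d) M ^+ 2).
Proof.
move=> xM; rewrite /enorm ler_wsqrtr//; apply: ler_sum => i _.
have xiM := le_trans (le_coord_norm x i) xM.
rewrite -[leLHS]real_normK ?num_real// ler_sqr ?nnegrE//.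
exact: le_trans xiM.
Qed.

Lemma norm_le_enorm x : `|x| <= enorm x.
Proof.
rewrite -[leLHS]/(mx_norm x) mx_normrE; apply: bigmax_le => /=; first exact: enorm_ge0.
move=> [i j] _ /=; rewrite ord1 -sqrtr_sqr ler_wsqrtr// (bigD1 j)//= lerDl.
by apply: sumr_ge0 => k _; exact: sqr_ge0.
Qed.

Lemma moderate_cst (c : R) : moderate (fun _ : Eps R => c).
Proof.
have [|c1] := leP c 1.
  by move=> c1; exists 0%N; apply: for_smallT => e; rewrite expr0 invr1.
have c0 : 0 < c by apply: lt_trans c1.
exists 1%N; apply: (@for_small_le _ _ c^-1); first by rewrite invr_gt0.
move=> e ec; rewrite expr1 -[leLHS]invrK lef_pV2 ?posrE ?Eps_gt0//.
by rewrite invr_gt0.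
Qed.

Lemma compact_net_point K (x : Eps R -> E) : compact K -> K `<=` O ->
  (forall e, K (x e)) ->
  exists X : moderate_points R d,
    (forall e, X e = x e) /\ compact_gpoints O (gpoint_class X).
Proof.
move=> cK KO Kx; have [M [_ KM]] := compact_bounded cK.
have mx : x \in @moderate_point_pred R d.
  (* Boundedness provides every number above [M] as a bound on [K], hence [M + 1]. *)
  apply/asboolP; have [N hN] := moderate_cst (Num.sqrt (\sum_(i < d) (M + 1) ^+ 2)).
  exists N; apply: for_smallS hN => e; apply: le_trans; apply: enorm_le.
  by apply: KM; [rewrite ltrDl|exact: Kx].
exists (ModeratePoint mx); split=> //.
exists K; first by split.
by exists (ModeratePoint mx); split=> //; exact: for_smallT.
Qed.

(* x is negligibly close to a representative that stays in a compact subset of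
   O, hence ends up in a compact neighbourhood of it. *)
Lemma gpoint_core (x : moderate_points R d) : open O ->
  compact_gpoints O (gpoint_class x) ->
  exists2 r, 0 < r & for_small (fun e => core O r (x e)).
Proof.
move=> oO [K [cK KO] [y [yx Ky]]].
have [r r01 Kr] := compact_sub_core oO cK KO.
have r0 : 0 < r by case/andP: r01.
exists (r / 2); first by rewrite divr_gt0.
have /asboolP xy : (y - x) \in @negligible_points R d.
  by rewrite Quotient.idealrBE; exact/eqP.
(* Negligibility with exponent 1 puts the two representatives at distance at most e <= r/4, strictly
   below the r/2 that [core_near] allows. *)
have small : for_small (fun e : Eps R => sval e <= r / 4).
  by apply: (@for_small_le _ _ (r / 4)) => //; rewrite divr_gt0.
apply: for_smallS (for_smallI Ky (for_smallI (xy 1%N) small)) => e [{}Ky [{}xy er]].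
apply: core_near r01 (Kr _ Ky) _; apply: le_lt_trans (norm_le_enorm _) _.
apply: le_lt_trans xy _; rewrite expr1 (le_lt_trans er)//.
by rewrite ltr_pM2l// ltf_pV2 ?posrE// ltr_nat.
Qed.

Lemma normc_mderiv_continuous (f : E -> C) alpha : csmooth_on setT f ->
  continuous (fun x => normc (mderiv alpha f x)).
Proof.
move=> [sr si] x.
have cr := (sr (midx_seq alpha) x I).1; have ci := (si (midx_seq alpha) x I).1.
set a := partials _ _ in cr; set b := partials _ _ in ci.
have c : {for x, continuous (a * a + b * b)}.
  by apply: continuousD; apply: continuousM.
exact: (continuous_comp c (@sqrt_continuous _ _)).
Qed.

Lemma mderiv_ext_sigL (f : E -> C) alpha : open O ->
  {in O, mderiv alpha (ext (sigL O f)) =1 mderiv alpha f}.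
Proof. by move=> oO; apply: cpartials_eq => //; exact: ext_sigL. Qed.

Lemma csmooth_ext_sigL (f : E -> C) : open O -> csmooth_on setT f ->
  csmooth_on O (ext (sigL O f)).
Proof.
move=> oO [sr si]; apply: (@csmooth_on_eq R d O f) => //.
  by move=> x xO; rewrite ext_sigL.
by split=> s x _; [exact: sr|exact: si].
Qed.

(** The comparison holds at every [e], so the same point transfers both moderateness and
    negligibility. It depends on [alpha], which is harmless because the growth conditions are
    checked for one [alpha] at a time. *)
Lemma net_max (u : Eps R -> E -> C) K alpha : (forall e, csmooth_on setT (u e)) ->
  open O -> compact K -> K `<=` O -> K !=set0 ->
  exists X : moderate_points R d, compact_gpoints O (gpoint_class X) /\
    forall e x, K x -> normc (mderiv alpha (ext (sigL O (u e))) x) <=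
                       normc (mderiv alpha (u e) (X e)).
Proof.
move=> su oO cK KO K0.
have /choice[x hx] : forall e, exists x, K x /\ forall y, K y ->
    normc (mderiv alpha (u e) y) <= normc (mderiv alpha (u e) x).
  move=> e; have cu := @normc_mderiv_continuous (u e) alpha (su e).
  have [x /set_mem Kx xmax] := compact_EVT_max K0 cK (continuous_subspaceT cu).
  by exists x; split=> // y Ky; apply: xmax; exact: mem_set.
have [X [Xx OX]] := compact_net_point cK KO (fun e => (hx e).1).
exists X; split=> // e y Ky.
have yO : y \in O by exact/mem_set/KO.
by rewrite mderiv_ext_sigL// Xx; exact: (hx e).2.
Qed.

Section Restriction.
Variable u : Eps R -> E -> C.
Hypotheses (oO : open O) (su : forall e, csmooth_on setT (u e)).
Local Notation restr := (fun e => sigL O (u e)).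

Lemma moderate_at_on : moderate_at (compact_gpoints O) u <-> moderate_on restr.
Proof.
split=> -[_ h].
  split=> [e|K cK KO alpha]; first exact: csmooth_ext_sigL.
  (* An empty [K] has no maximum point, but there any exponent will do. *)
  have [K0|/set0P K0] := eqVneq K set0.
    by exists 0%N; apply: for_smallT => e x; rewrite K0.
  have [X [OX hX]] := net_max alpha su oO cK KO K0.
  have [N hN] := h alpha _ OX X erefl.
  exists N; apply: for_smallS hN => e he x Kx; exact: le_trans (hX e x Kx) he.
split=> // alpha X OX x xX.
rewrite -xX in OX; have [r r0 rx] := gpoint_core oO OX.
have rO := @core_sub _ _ O r r0.
have [N hN] := h _ (core_compact r0) rO alpha.
exists N; apply: for_smallS (for_smallI rx hN) => e [{}rx /(_ _ rx)].
by rewrite mderiv_ext_sigL//; exact/mem_set/rO.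
Qed.

Lemma negligible_at_on : negligible_at (compact_gpoints O) u <-> negligible_on restr.
Proof.
split=> -[_ h].
  split=> [e|K cK KO alpha m]; first exact: csmooth_ext_sigL.
  have [K0|/set0P K0] := eqVneq K set0.
    by apply: for_smallT => e x; rewrite K0.
  have [X [OX hX]] := net_max alpha su oO cK KO K0.
  apply: for_smallS (h alpha _ OX X erefl m) => e he x Kx.
  exact: le_trans (hX e x Kx) he.
split=> // alpha X OX x xX m.
rewrite -xX in OX; have [r r0 rx] := gpoint_core oO OX.
have rO := @core_sub _ _ O r r0.
have hN := h _ (core_compact r0) rO alpha m.
apply: for_smallS (for_smallI rx hN) => e [{}rx /(_ _ rx)].
by rewrite mderiv_ext_sigL//; exact/mem_set/rO.
Qed.

End Restriction.

(** * Extension of nets from the open set to the whole space *)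

(** Inside [O] both factors are smooth. Around a point outside [O] the product is locally zero,
    whatever the values of [f] there. *)
Lemma smooth_on_mul_cutoff (chi f : E -> R) : open O -> smooth_on setT chi ->
  smooth_on O f -> (forall x, ~ O x -> \forall y \near x, chi y = 0) ->
  smooth_on setT (chi * f).
Proof.
move=> oO sc sf chi0 s x _.
have [Ox|nOx] := pselect (O x).
  have scO : smooth_on O chi by move=> s' y _; exact: sc.
  exact: (smooth_onM oO scO sf).
have : \forall y \near x, cst 0 y = (chi * f) y.
  by apply: filterS (chi0 x nOx) => y chiy; rewrite !fctE chiy mul0r.
move=> /nbhs_ballP[r /= r0 xr]; pose U : set E := ball x r.
have sU : smooth_on U (chi * f).
  apply: smooth_on_eq (@smooth_on_cst R d U 0); first exact: ball_open.
  by move=> y /set_mem /xr.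
exact: (sU s x (ballxx x r0)).
Qed.

(** The cutoff at index [e] is 1 near [core O e], which contains [K] as soon as [e <= r] for some
    [r] with [K] inside [core O r]. Agreement on neighbourhoods, not just on [K], makes all
    derivatives agree on [K]. *)
Lemma exists_global_net (v : Eps R -> O -> C) : open O ->
  (forall e, csmooth_on O (ext (v e))) ->
  exists u : Eps R -> E -> C, (forall e, csmooth_on setT (u e)) /\
    forall K, compact K -> K `<=` O ->
      for_small (fun e => forall x, K x -> \forall y \near x, u e y = ext (v e) y).
Proof.
move=> oO sv.
have /choice[chi hchi] : forall e : Eps R, exists chi : E -> R,
    [/\ smooth_on setT chi,
    forall x, core O (sval e) x -> \forall y \near x, chi y = 1 &
    forall x, ~ O x -> \forall y \near x, chi y = 0].
  move=> e; apply: exists_cutoff => //; first by apply: core_compact; exact: Eps_gt0.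
  by apply: core_sub; exact: Eps_gt0.
exists (fun e x => (chi e x)%:C%C * ext (v e) x); split=> [e|K cK KO].
  have [sc _ chi0] := hchi e; have [sr si] := sv e; split.
    rewrite (_ : _ \o _ = chi e * (@complex.Re R \o ext (v e))).
      exact: smooth_on_mul_cutoff.
    by apply/funext => x; rewrite !fctE/=; case: (ext _ x) => a b /=; rewrite mul0r subr0.
  rewrite (_ : _ \o _ = chi e * (@complex.Im R \o ext (v e))).
    exact: smooth_on_mul_cutoff.
  by apply/funext => x; rewrite !fctE/=; case: (ext _ x) => a b /=; rewrite mul0r addr0.
have [r /andP[r0 r1] Kr] := compact_sub_core oO cK KO.
apply: (for_small_le r0) => e er x /Kr/(core_le (Eps_gt0 e) er) xe.
have [_ /(_ x xe) chi1 _] := hchi e.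
by apply: filterS chi1 => y ->; rewrite mul1r.
Qed.

Lemma mderiv_near_eq (f g : E -> C) alpha x : (\forall y \near x, f y = g y) ->
  mderiv alpha f x = mderiv alpha g x.
Proof.
move=> /nbhs_ballP[r /= r0 xr].
have fg : {in (ball x r : set E), f =1 g} by move=> y /set_mem /xr.
have oB : open (ball x r : set E) by exact: ball_open.
exact: (cpartials_eq (midx_seq alpha) oB fg (mem_set (ballxx x r0))).
Qed.

End CompactlySupportedPoints.

(** * The restriction morphism *)

Section RestrictionMorphism.
Variables (R : realType) (d : nat) (O : set 'rV[R]_d).
Hypotheses (oO : open O) (O0 : O !=set0).
Local Notation E := 'rV[R]_d.
Local Notation C := R[i].
Local Notation GT := (gtilde (compact_gpoints_neq0 O0)).
Local Notation G := (colombeau oO O0).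
Local Notation EMT := (moderate_gnets (compact_gpoints_neq0 O0)).
Local Notation EM := (moderate_nets oO O0).

Lemma restrict_moderate (u : EMT) : moderate_on (fun e => sigL O (u e)).
Proof.
have hu := moderate_gnetP u.
exact: (iffLR (moderate_at_on oO hu.1) hu).
Qed.

Definition restrict (u : EMT) : EM := ModerateNet (asboolT (restrict_moderate u)).

Lemma restrictE (u : EMT) e : restrict u e = sigL O (u e).
Proof. by []. Qed.

Lemma restrictB u v : restrict (u - v) = restrict u - restrict v.
Proof. exact/val_inj. Qed.

Lemma restrictM u v : restrict (u * v) = restrict u * restrict v.
Proof. exact/val_inj. Qed.

Lemma restrict1 : restrict 1 = 1.
Proof. exact/val_inj. Qed.

Lemma restrictZ (c : C) u : restrict (c *: u) = c *: restrict u.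
Proof. exact/val_inj. Qed.

Lemma colombeau_class_eq (u v : EM) :
  colombeau_class u = colombeau_class v <-> negligible_on (u - v : EM).
Proof.
split=> [/eqP|h].
  by rewrite -Quotient.idealrBE => /asboolP.
by apply/eqP; rewrite -Quotient.idealrBE; apply/asboolP.
Qed.

Lemma gtilde_class_eq (u v : EMT) :
  gtilde_class u = gtilde_class v <-> negligible_at (compact_gpoints O) (u - v : EMT).
Proof.
split=> [/eqP|h].
  by rewrite -Quotient.idealrBE => /asboolP.
by apply/eqP; rewrite -Quotient.idealrBE; apply/asboolP.
Qed.

(** One direction is well-definedness on classes, the other is injectivity; both are
    [negligible_at_on] for the difference [u - v]. *)
Lemma restrict_class_eq (u v : EMT) :
  colombeau_class (restrict u) = colombeau_class (restrict v) <->
  gtilde_class u = gtilde_class v.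
Proof.
rewrite colombeau_class_eq gtilde_class_eq -restrictB.
have su := (moderate_gnetP (u - v)).1.
by split=> h; apply/(negligible_at_on oO su).
Qed.

(** Uses the chosen representative; [restrict_classE] shows that any other gives the same class. *)
Definition restrict_class (U : GT) : G := colombeau_class (restrict (repr U)).

Lemma gtilde_class_repr (U : GT) : gtilde_class (repr U) = U.
Proof. exact: reprK. Qed.

Lemma restrict_classE u : restrict_class (gtilde_class u) = colombeau_class (restrict u).
Proof. by apply/restrict_class_eq; rewrite gtilde_class_repr. Qed.

Lemma restrict_class_is_zmod_morphism : zmod_morphism restrict_class.
Proof.
move=> U V; rewrite -[U]gtilde_class_repr -[V]gtilde_class_repr.
rewrite (_ : gtilde_class _ - _ = gtilde_class (repr U - repr V)); last first.
  by rewrite /gtilde_class rmorphB.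
rewrite !restrict_classE restrictB /colombeau_class; exact: rmorphB.
Qed.

Lemma restrict_class_is_monoid_morphism : monoid_morphism restrict_class.
Proof.
split=> [|U V].
  rewrite (_ : 1 = gtilde_class 1); last by rewrite /gtilde_class rmorph1.
  by rewrite restrict_classE restrict1 /colombeau_class rmorph1.
rewrite -[U]gtilde_class_repr -[V]gtilde_class_repr.
rewrite (_ : gtilde_class _ * _ = gtilde_class (repr U * repr V)); last first.
  by rewrite /gtilde_class rmorphM.
rewrite !restrict_classE restrictM /colombeau_class; exact: rmorphM.
Qed.

Lemma restrict_class_is_scalable : scalable restrict_class.
Proof.
move=> c U; rewrite -[U]gtilde_class_repr.
rewrite (_ : c *: _ = gtilde_class (c *: repr U)); last exact: pi_scale.
by rewrite !restrict_classE restrictZ /colombeau_class -pi_scale.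
Qed.

HB.instance Definition _ :=
  GRing.isZmodMorphism.Build GT G restrict_class restrict_class_is_zmod_morphism.
HB.instance Definition _ :=
  GRing.isMonoidMorphism.Build GT G restrict_class restrict_class_is_monoid_morphism.
HB.instance Definition _ :=
  GRing.isScalable.Build C GT G *:%R restrict_class restrict_class_is_scalable.

Lemma restrict_class_inj : injective restrict_class.
Proof.
by move=> U V /restrict_class_eq; rewrite !gtilde_class_repr.
Qed.

(** A representative [v] is cut off to a global net [u]. For small [e] the two agree near a given
    compact set, so [u] inherits the moderate bounds of [v], and the restriction of [u] differs from
    [v] by a negligible net. *)
Lemma restrict_class_surj (V : G) : exists U, restrict_class U = V.
Proof.
set v : EM := repr V; have Vv : V = colombeau_class v by rewrite /colombeau_class reprK.
have [sv hv] := moderate_netP v.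
have [u [su uv]] := exists_global_net oO sv.
have mu : moderate_on (fun e => sigL O (u e)).
  split=> [e|K cK KO alpha]; first exact: csmooth_ext_sigL.
  have [N hN] := hv K cK KO alpha; exists N.
  apply: for_smallS (for_smallI (uv K cK KO) hN) => e [{}uv {}hN] x Kx.
  rewrite mderiv_ext_sigL//; last exact/mem_set/KO.
  by rewrite (mderiv_near_eq alpha (uv x Kx)); exact: hN.
have mu' : moderate_at (compact_gpoints O) u by exact/(moderate_at_on oO su).
pose w : EMT := ModerateGNet (asboolT mu').
exists (gtilde_class w); rewrite restrict_classE Vv; apply/colombeau_class_eq.
split=> [e|K cK KO alpha m]; first exact: (moderate_netP (restrict w - v : EM)).1.
apply: for_smallS (uv K cK KO) => e {}uv x Kx.
(* The difference is zero near [x], so all its derivatives at [x] vanish and every power of [e]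
   bounds them. *)
have -> : mderiv alpha (ext ((restrict w - v : EM) e)) x = mderiv alpha (cst 0) x.
  apply: mderiv_near_eq.
  have Ox : nbhs x O by apply: open_nbhs_nbhs; split=> //; exact: KO.
  have uvx := uv x Kx; near=> y.
  have Oy : O y by near: y.
  have uvy : u e y = ext (v e) y by near: y.
  pose z : O := exist _ y (mem_set Oy).
  have := extE (v e) z; rewrite /= -uvy => uz.
  have := extE ((restrict w - v : EM) e) z; rewrite /= => ->.
  by rewrite -[LHS]/(u e y - v e z) uz subrr.
rewrite /mderiv cpartials_cst.
by case: midx_seq => [|? ?]; rewrite ComplexField.Normc.normc0 exprn_ge0// ltW// Eps_gt0.
Unshelve. all: by end_near.
Qed.

Lemma restrict_class_bij : bijective restrict_class.
Proof.
have /choice[g gK] := restrict_class_surj.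
by exists g => // U; apply: restrict_class_inj; rewrite gK.
Qed.

(** On representatives, the zero extension of the restriction agrees with the global net on the open
    set [O], hence so do their partial derivatives there. *)
Lemma restrict_class_pderiv i U :
  restrict_class (gtilde_pderiv i U) = colombeau_pderiv i (restrict_class U).
Proof.
rewrite -[U]gtilde_class_repr gtilde_pderivE !restrict_classE colombeau_pderivE.
congr colombeau_class; apply/val_inj/funext => e; apply/funext => -[x xO] /=.
exact/esym/(cpartials_eq [:: i] oO (ext_sigL _) xO).
Qed.

End RestrictionMorphism.

Theorem corollary3p10 (R : realType) (d : nat) (Omega : set 'rV[R]_d)
    (oO : open Omega) (O0 : Omega !=set0) :
  exists Phi : {lrmorphism gtilde (compact_gpoints_neq0 O0) -> colombeau oO O0},
    [/\ forall u : moderate_gnets (compact_gpoints_neq0 O0),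
          exists v : moderate_nets oO O0,
            (forall e : Eps R, v e = sigL Omega (u e)) /\
            Phi (gtilde_class u) = colombeau_class v,
        bijective Phi &
        forall (i : 'I_d) (U : gtilde (compact_gpoints_neq0 O0)),
          Phi (gtilde_pderiv i U) = colombeau_pderiv i (Phi U)].

Proof.
exists (@restrict_class R d Omega oO O0 : {lrmorphism _ -> _}); split.
- by move=> u; exists (restrict oO u); split=> [e|]; [exact: restrictE|exact: restrict_classE].
- exact: restrict_class_bij.
- exact: restrict_class_pderiv.
Qed.
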